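(* Let $X$ be a locally compact, second countable, homogeneous space, $H$ a locally compact second countable group acting continuously on $X$, and $m_X$ an $H$-invariant probability measure on $X$ such that the action of $H$ on $(X,m_X)$ is mixing. Let $\{a_t:t\in\mathbb{R}\}$ be a one-parameter subgroup of $H$ such that $a_t\to\infty$ as $t\to\infty$ (i.e. $a_t$ leaves all compact subsets of $H$). Let $K$ be a compact subgroup of $H$ commuting with $\{a_t:t\in\mathbb{R}\}$, and let $\nu$ be a probability measure on $H$ supported on elements of the form $\{a_tk: t\in[c,d],\ k\in K\}$ for some $[c,d]\subset(0,\infty)$. Then for any $x\in X$, $$\lim_{T\to\infty}\frac1T\int_0^T\delta_{a_tx}\,dt=m_X$$ holds if and only if for $\nu^{\otimes\mathbb{N}}$-almost every $(b_p)_{p\in\mathbb{N}}\in H^{\mathbb{N}}$, $$\frac1N\sum_{p=1}^N\delta_{b_p\cdots b_1x}\longrightarrow m_X\quad\text{as }N\to\infty.$$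
   Context: Convergence of measures is weak-* convergence (tested against continuous compactly supported functions on $X$). *)

(* Defs.v *)
From HB Require Import structures.
From mathcomp Require Import all_boot all_order all_algebra.
From mathcomp Require Import all_classical all_reals all_analysis.
Set Implicit Arguments.
Unset Strict Implicit.
Unset Printing Implicit Defensive.
Import Order.TTheory GRing.Theory Num.Theory.
Import numFieldNormedType.Exports.
Local Open Scope classical_set_scope.
Local Open Scope ring_scope.

(* Multiplicative, not necessarily commutative, topological groups.  The
   [Pointed] structure carries no content (a group is nonempty); the library
   requires it of every measurable type. *)
HB.mixin Record isTopologicalGroup G of PointedTopological G & Group G := {
  mulg_continuous : continuous (fun z : G * G => (z.1 * z.2)%g) ;
  invg_continuous : continuous (fun g : G => (g^-1)%g)
}.

#[short(type="topologicalGroupType")]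
HB.structure Definition TopologicalGroup :=
  {G of PointedTopological G & Group G & isTopologicalGroup G}.

Definition borel (T : ptopologicalType) : measurableType _ :=
  g_sigma_algebraType (@open T).

(* "Locally compact" and "second countable" spaces are Hausdorff by
   convention; the library keeps the three properties separate. *)
Definition lcsc (T : topologicalType) : Prop :=
  [/\ hausdorff_space T, locally_compact [set: T] & @second_countable T].

Definition continuous_action (G : topologicalGroupType) (X : topologicalType)
    (act : G -> X -> X) : Prop :=
  [/\ forall x, act 1%g x = x,
      forall g h x, act (g * h)%g x = act g (act h x)
    & continuous (fun z : G * X => act z.1 z.2)].

(* X is a homogeneous space of a topological group G.  Openness of the orbit
   maps says that the bijection g G_x |-> g x is a homeomorphism from the
   quotient of G by the stabiliser G_x onto X; it is automatic when G is
   locally compact second countable. *)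
Definition homogeneous_space (X : topologicalType) : Prop :=
  exists (G : topologicalGroupType) (act : G -> X -> X),
    [/\ continuous_action act,
        forall x y, exists g, act g x = y
      & forall x (U : set G), open U -> open ((act^~ x) @` U)].

(* The filter of neighbourhoods of infinity: complements of compact sets. *)
Definition at_infinity (T : topologicalType) : set_system T :=
  filter_from (@compact T) (fun C => ~` C).

Definition one_parameter_subgroup (R : realType) (H : topologicalGroupType)
    (a : R -> H) : Prop :=
  continuous a /\ forall s t, a (s + t) = (a s * a t)%g.

Definition compact_subgroup (H : topologicalGroupType) (K : set H) : Prop :=
  [/\ compact K, K 1%g, forall g h, K g -> K h -> K (g * h)%g
    & forall g, K g -> K (g^-1)%g].

Arguments at_infinity : clear implicits.

Section measures.
Context (R : realType) (X : ptopologicalType) (H : topologicalGroupType).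
Local Open Scope ereal_scope.

Definition invariant_measure (act : H -> X -> X)
    (m : probability (borel X) R) : Prop :=
  forall h (A : set (borel X)), measurable A -> m (act h @^-1` A) = m A.

Definition mixing (act : H -> X -> X) (m : probability (borel X) R) : Prop :=
  forall A B : set (borel X), measurable A -> measurable B ->
    m (A `&` act h @^-1` B) @[h --> at_infinity H] --> m A * m B.

Definition weak_star_cvg (I : Type) (F : set_system I)
    (mu : I -> set (borel X) -> \bar R) (m : set (borel X) -> \bar R) : Prop :=
  forall f : X -> R, continuous f -> compact (closure [set y | f y != 0%R]) ->
    \int[mu i]_y (f y)%:E @[i --> F] --> \int[m]_y (f y)%:E.

(* (1/T) \int_0^T \delta_(a_t x) dt, evaluated on each set A. *)
Definition flow_average (act : H -> X -> X) (a : R -> H) (x : X) (T : R)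
    (A : set (borel X)) : \bar R :=
  T^-1%:E *
    \int[lebesgue_measure]_(t in `[0%R, T]) \d_(act (a t) x : borel X) A.

(* [walk b p] is b_p * ... * b_1; the sequence (b_1, b_2, ...) is stored with
   indices starting at 0, so that b_p is [b p.-1]. *)
Fixpoint walk (b : nat -> H) (p : nat) : H :=
  if p is q.+1 then (b q * walk b q)%g else 1%g.

(* (1/N) \sum_(p = 1)^N \delta_(b_p ... b_1 x), evaluated on each set A. *)
Definition walk_average (act : H -> X -> X) (b : nat -> H) (x : X) (N : nat)
    (A : set (borel X)) : \bar R :=
  (N%:R^-1 : R)%:E *
    \sum_(1 <= p < N.+1) \d_(act (walk b p) x : borel X) A.

Definition coordinate_sets : set_system (nat -> borel H) :=
  \bigcup_(i in [set: nat])
    preimage_set_system setT (fun b : nat -> borel H => b i) measurable.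

(* H^N with the product sigma-algebra. *)
Definition seq_space : measurableType _ := g_sigma_algebraType coordinate_sets.

(* P is the product measure nu^(\otimes N): the product rule determines P on
   the pi-system of cylinders, hence on the product sigma-algebra. *)
Definition is_infinite_product (nu : probability (borel H) R)
    (P : probability seq_space R) : Prop :=
  forall (n : nat) (A : nat -> set (borel H)),
    (forall i, measurable (A i)) ->
    P [set b | forall i, (i < n)%N -> A i (b i)] = \prod_(i < n) nu (A i).

End measures.

(* Main.v *)
Require Import Defs.
From HB Require Import structures.
From mathcomp Require Import all_boot all_order all_algebra.
From mathcomp Require Import all_classical all_reals all_analysis.
From mathcomp Require Import measurable_realfun.
From mathcomp Require Import ring lra zify.
Set Implicit Arguments.
Unset Strict Implicit.
Unset Printing Implicit Defensive.
Import Order.TTheory GRing.Theory Num.Theory.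
Import numFieldNormedType.Exports.
Local Open Scope classical_set_scope.
Local Open Scope ring_scope.

(** Why the theorem holds.  Write [P f y] for the integral of [f (h y)] against
[nu], and [X_p = b_p ... b_1 x].  As [K] commutes with the flow, [X_p] is
[(a (S p) * kap p) x] with [kap p] in [K] and with increments of [S] in [[c, d]]
([walk_decomposition]): the walk follows the flow orbit of [x] up to a bounded
displacement, spending between [c] and [d] units of time in each step.

Let [h >= 0] be bounded and continuous, and vary by at most [e] under
translations by the elements of a neighbourhood [G] of [1] that commute with
the flow.  Covering the compact set of possible displacements by finitely many
translates of [G] bounds the averages of [h] along the walk by a multiple of
[e] plus averages along the flow of a finite sum of translates of [h], and
conversely ([walk_dominated], [flow_dominated]).  If one of the two averages
converges to [m], the other one therefore has, in the limit, means of [h] at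
most [A * e + C * m(h)]; here [C] depends on [G] only, not on [h]
([orbit_dominated]).

This applies to [h = |g - m(f)|], where [f] is continuous with compact support
and [g] is an average of iterates [P^n f].  The modulus of continuity of [f] in
the sense above passes to [P^n f] ([conj_modulus_iter]), hence [G] and [C] are
fixed before [g] is chosen.  By mixing, [g] can be chosen with [m(h)] as small
as desired ([mean_ergodic]).  So the means of [g] tend to [m(f)], and those of
[f] do too provided that [f] and [P f] have asymptotically equal means
([orbit_dominated_cvg]).

For the flow, [nu] is replaced by the Dirac mass at [a 1]; then [P] is
composition with the time-one map, and [f], [P f] trivially have
asymptotically equal means ([flow_mean_invariant]).  For the walk,
[f (X_(p+1)) - P f (X_p)] is a bounded sequence of martingale differences, and
its Cesaro means tend to [0] almost surely ([walk_transfer_law]).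

Two points remain.  The null set must not depend on [f]: a countable family of
Urysohn functions determines the convergence ([countable_test_family],
[test_family_cvg]).  And [h] has no compact support: since the limit [m] has
mass one, no mass escapes to infinity and the convergence extends to bounded
continuous functions ([Cc_cvg_bcont]). *)

(** * Compactness and functions of compact support *)

(** If [P A] failed, the sets [B] with [P (A `\` B)] would form a proper filter
containing [A]; a cluster point in [A] contradicts the local assumption.  Finite
covers, uniform bounds and Urysohn functions on compact sets are all obtained by
this induction. *)
Lemma compact_set_ind (T : topologicalType) (P : set T -> Prop) (A : set T) :
  P set0 -> (forall B C, P B -> P C -> P (B `|` C)) ->
  (forall B C, B `<=` C -> P C -> P B) ->
  (forall x, A x -> exists2 U, nbhs x U & P U) ->
  compact A -> P A.
Proof.
move=> P0 PU PS Ploc cA; apply: contrapT => nPA.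
pose F : set_system T := [set B | P (A `\` B)].
have FF : ProperFilter F.
  split; first by rewrite /F /= setD0.
  split; rewrite /F /=.
  - by rewrite setDT.
  - move=> B C PB PC; apply: PS (PU _ _ PB PC) => t [At nBC].
    have [Bt|nBt] := pselect (B t); last by left.
    by right; split=> // Ct; apply: nBC.
  - move=> B C BC; apply: PS => t [At nCt]; split=> // /BC.
    exact: nCt.
have FA : F A by rewrite /F /= setDv.
have [x [Ax clx]] := cA F FF FA.
have [U Ux PU'] := Ploc x Ax.
have FCU : F (~` U) by apply: PS PU' => t [_] /contrapT.
by have [t [nUt Ut]] := clx _ _ FCU Ux.
Qed.

Lemma compact_seq_cover (T : topologicalType) (I : eqType) (D : set I)
    (U : I -> set T) (A : set T) :
  (forall x, A x -> exists2 i, D i & nbhs x (U i)) -> compact A ->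
  exists2 s : seq I, (forall i, i \in s -> D i) &
    forall y, A y -> exists2 i, i \in s & U i y.
Proof.
move=> cov; apply: (@compact_set_ind _ (fun B => exists2 s : seq I,
  (forall i, i \in s -> D i) & forall y, B y -> exists2 i, i \in s & U i y)).
- by exists [::].
- move=> B C [s sD sB] [t tD tC]; exists (s ++ t).
    by move=> i; rewrite mem_cat => /orP[/sD|/tD].
  move=> y [/sB|/tC] [i iI Ui]; exists i => //; rewrite mem_cat iI ?orbT//.
- by move=> B C BC [s sD sC]; exists s => // y /BC/sC.
- move=> x /cov [i Di Ui]; exists (U i) => //; exists [:: i].
    by move=> j; rewrite inE => /eqP ->.
  by move=> y Uy; exists i; rewrite ?inE.
Qed.

Lemma countable_basis_sequence (X : topologicalType) : @second_countable X ->
  exists V : nat -> set X, (forall i, open (V i)) /\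
    forall x U, nbhs x U -> exists2 i, V i x & V i `<=` U.
Proof.
move=> [B /countable_injP[e inje] [oB bB]].
exists (fun i => \bigcup_(G in B `&` [set G | e G = i]) G); split.
  by move=> i; apply: bigcup_open => G [BG _]; exact: oB.
move=> x U /bB [G [BG Gx] GU]; exists (e G); first by exists G.
move=> y [G' [BG' eG'] G'y]; apply: GU => /=.
suff <- : G' = G by [].
by apply: inje; rewrite ?inE.
Qed.

Section compact_support.
Variable R : realType.

Definition Cc (X : topologicalType) (f : X -> R) : Prop :=
  continuous f /\ compact (closure [set y | f y != 0]).

Lemma compact_supportS (X : topologicalType) (f : X -> R) (A : set X) :
  closed A -> compact A -> (forall y, ~ A y -> f y = 0) ->
  compact (closure [set y | f y != 0]).
Proof.
move=> clA cA f0; apply: (subclosed_compact _ cA); first exact: closed_closure.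
rewrite [X in _ `<=` X]((closure_id A).1 clA); apply: closureS => y /= /eqP fy.
by apply: contrapT => /f0.
Qed.

Lemma Cc_comp2 (X : topologicalType) (f g : X -> R) (op : R -> R -> R) :
  op 0 0 = 0 ->
  (continuous f -> continuous g -> continuous (fun y => op (f y) (g y))) ->
  Cc f -> Cc g -> Cc (fun y => op (f y) (g y)).
Proof.
move=> op0 opc [cf kf] [cg kg]; split; first exact: opc.
apply: (@compact_supportS _ _
  (closure [set y | f y != 0] `|` closure [set y | g y != 0])).
- by apply: closedU; exact: closed_closure.
- exact: compactU.
- move=> y; rewrite -closureU => nA.
  have nfg : ~ ((f y != 0) \/ (g y != 0)).
    by move=> fg; apply: nA; apply: subset_closure.
  have -> : f y = 0 by apply/eqP/negPn/negP => ?; apply: nfg; left.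
  by have -> : g y = 0 by apply/eqP/negPn/negP => ?; apply: nfg; right.
Qed.

Lemma compact_ge_Cc (X : topologicalType) (f : X -> R) (r : R) :
  Cc f -> 0 < r -> compact [set y | r <= f y].
Proof.
move=> [cf kf] r0; apply: (subclosed_compact _ kf).
  exact: (@closed_comp _ _ f [set z | r <= z] (fun x _ => cf x)
    (closed_ge (y := r))).
move=> y /= ry; apply: subset_closure => /=; rewrite gt_eqF//.
exact: lt_le_trans ry.
Qed.

(** The continuous piecewise affine function of slope [a] between its plateaus,
equal to [1] from [1 / 2] on. *)
Let ramp (a : R) (e : R) : R := Num.min 1 (Num.max 0 (a * e - (a / 2 - 1))).

Let ramp_continuous a : continuous (ramp a).
Proof.
move=> e; rewrite /ramp.
apply: (@continuous_min _ R (cst 1) _ e); first exact: cst_continuous.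
apply: (@continuous_max _ R (cst 0) _ e); first exact: cst_continuous.
apply: (@continuousB _ R _ ( *%R a) (cst (a / 2 - 1)) e).
  exact: mulrl_continuous.
exact: cst_continuous.
Qed.

Let ramp_ge0 a e : 0 <= ramp a e.
Proof. by rewrite /ramp le_min ler01 le_max lexx. Qed.

Let ramp_le1 a e : ramp a e <= 1.
Proof. by rewrite /ramp ge_min lexx. Qed.

Let ramp1 a e : 0 <= a -> 1 / 2 <= e -> ramp a e = 1.
Proof.
move=> a0 e2; have ae : 1 <= a * e - (a / 2 - 1).
  by have := ler_wpM2l a0 e2; lra.
have ae0 : 0 <= a * e - (a / 2 - 1) by apply: le_trans ae.
by rewrite /ramp (max_r ae0) (min_l ae).
Qed.

Let ramp0 a e : a * e <= a / 2 - 1 -> ramp a e = 0.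
Proof.
move=> ae; have ae0 : a * e - (a / 2 - 1) <= 0 by lra.
by rewrite /ramp (max_l ae0) (min_r ler01).
Qed.

(** Local compactness and complete regularity give such a function for a small
neighbourhood of each point of [C]; finitely many of them are glued by taking
maxima. *)
Lemma urysohn_locally_compact (X : topologicalType) (C U : set X) :
  hausdorff_space X -> locally_compact [set: X] ->
  compact C -> open U -> C `<=` U ->
  exists f : X -> R, [/\ Cc f, forall y, 0 <= f y <= 1,
    forall y, C y -> f y = 1 & forall y, ~ U y -> f y = 0].
Proof.
move=> hX lcX cC oU CU.
apply: (@compact_set_ind _ (fun C => exists f : X -> R,
  [/\ Cc f, forall y, 0 <= f y <= 1,
    forall y, C y -> f y = 1 & forall y, ~ U y -> f y = 0])); last exact: cC.
- exists (cst 0); split=> //; last by move=> y; rewrite lexx ler01.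
  split; first exact: cst_continuous.
  apply: (@compact_supportS _ _ set0) => //; first exact: closed0.
  exact: compact0.
- move=> A B [f [cf f01 f1 f0]] [g [cg g01 g1 g0]].
  exists (fun y => Num.max (f y) (g y)); split.
  + apply: Cc_comp2 cf cg; first by rewrite maxxx.
    by move=> cf cg y; apply: continuous_max; [exact: cf|exact: cg].
  + move=> y; have /andP[? ?] := f01 y; have /andP[? ?] := g01 y.
    by rewrite le_max ge_max; apply/andP; split; [apply/orP; left|apply/andP].
  + move=> y [/f1 ->|/g1 ->]; have /andP[? ?] := f01 y;
      have /andP[? ?] := g01 y; [exact: max_l|exact: max_r].
  + by move=> y Uy; rewrite f0// g0// maxxx.
- move=> A B AB [f [cf f01 f1 f0]]; exists f; split=> // y Ay.
  by apply: f1; exact: AB.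
- move=> x Cx; have [V] := lcX x I.
  rewrite withinE //= => -[V' V'x V'V] [cV clV].
  have Vx : nbhs x V.
    by apply: filterS V'x => z V'z; have : (V' `&` setT) z by []; rewrite -V'V => -[].
  pose W := U `&` V°.
  have oW : open W by apply: openI => //; exact: open_interior.
  have Wx : W x by split; [exact: CU|exact: Vx].
  have := @locally_compact_completely_regular X R lcX hX x (~` W)
    (open_closedC oW) (fun h => h Wx).
  move=> /(@uniform_separatorP _ R) [f0 [cf0 f001 f0x f0W]].
  pose f y := ramp 2 (1 - f0 y).
  have fW y : ~ W y -> f y = 0.
    move=> Wy; have -> : f y = ramp 2 0.
      by rewrite /f (_ : f0 y = 1) ?subrr//; apply: f0W; exists y.
    by apply: ramp0; lra.
  have cont1 : continuous (fun y => 1 - f0 y).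
    by move=> y; apply: continuousB; [exact: cst_continuous|exact: cf0].
  exists [set y | 1 / 2 < 1 - f0 y].
    apply: open_nbhs_nbhs; split.
      exact: (@open_comp _ _ (fun y => 1 - f0 y) [set z | 1 / 2 < z]
        (fun x _ => cont1 x) (open_gt (y := 1/2))).
    rewrite /= (_ : f0 x = 0); last by apply: f0x; exists x.
    lra.
  exists f; split.
  + split; last first.
      by apply: (@compact_supportS _ _ V) => // y Vy; apply: fW => -[_ /interior_subset].
    by move=> y; apply: (@continuous_comp _ _ _ (fun y => 1 - f0 y) (ramp 2));
      [exact: cont1|exact: ramp_continuous].
  + by move=> y; rewrite /f ramp_ge0 ramp_le1.
  + by move=> y /= /ltW ?; apply: ramp1 => //; lra.
  + by move=> y Uy; apply: fW => -[].
Qed.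

Definition test_family (X : topologicalType) (Phi : nat -> X -> R) : Prop :=
  (forall n, Cc (Phi n) /\ forall y, 0 <= Phi n y <= 1) /\
  forall C U, compact C -> open U -> C `<=` U ->
    exists n, (forall y, C y -> Phi n y = 1) /\
              (forall y, ~ U y -> Phi n y = 0).

(** A Urysohn function for [C] in [U] can be sharpened to be [1] on a finite union
of basic open sets containing [C] and [0] off another one contained in [U].  It
thus suffices to choose one function for each pair of finite unions, and there
are only countably many pairs. *)
Lemma countable_test_family (X : topologicalType) : lcsc X ->
  exists Phi : nat -> X -> R, test_family Phi.
Proof.
move=> [hX lcX /countable_basis_sequence[V [oV bV]]].
pose un (s : seq nat) : set X := [set y | exists2 i, i \in s & V i y].
have unb C U : compact C -> open U -> C `<=` U ->
    exists s : seq nat, C `<=` un s /\ un s `<=` U.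
  move=> cC oU CU.
  have cov x : C x -> exists2 i, V i `<=` U & nbhs x (V i).
    move=> Cx; have [i Vix ViU] := bV x U (open_nbhs_nbhs (conj oU (CU x Cx))).
    by exists i => //; exact: open_nbhs_nbhs.
  have [s sU Cs] := compact_seq_cover cov cC.
  by exists s; split=> // y [i /sU]; exact.
pose good (p : seq nat * seq nat) (f : X -> R) := [/\ Cc f,
  forall y, 0 <= f y <= 1, forall y, un p.1 y -> f y = 1 &
  forall y, ~ un p.2 y -> f y = 0].
have Cc0 : Cc (cst 0 : X -> R).
  split; first exact: cst_continuous.
  apply: (@compact_supportS _ _ set0) => //; first exact: closed0.
  exact: compact0.
pose Psi p : X -> R := if pselect (exists f, good p f) is left h
  then projT1 (cid h) else cst 0.
have PsiP p : Cc (Psi p) /\ forall y, 0 <= Psi p y <= 1.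
  rewrite /Psi; case: pselect => [h|_]; first by case: cid => f [].
  by split=> // y; rewrite lexx ler01.
exists (fun n => Psi (odflt ([::], [::]) (unpickle n))); split=> // C U cC oU CU.
have [f [ccf f01 f1 f0]] := urysohn_locally_compact hX lcX cC oU CU.
have cf : continuous f by case: ccf.
have [s1 [Cs1 s1f]] : exists s1, C `<=` un s1 /\ un s1 `<=` [set y | 1 / 2 < f y].
  apply: unb => //.
    exact: (@open_comp _ _ f [set z | 1 / 2 < z]
        (fun x _ => cf x) (open_gt (y := 1/2))).
  by move=> y /f1 /= ->; lra.
have [s2 [fs2 s2U]] : exists s2, [set y | 1 / 4 <= f y] `<=` un s2 /\ un s2 `<=` U.
  apply: unb => //; first by apply: compact_ge_Cc => //; lra.
  by move=> y /= fy; apply: contrapT => /f0 fy0; move: fy; rewrite fy0; lra.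
(* Steepening f to slope 4 makes it vanish where f <= 1/4, hence off un s2,
   while it becomes 1 where f > 1/2, hence on un s1. *)
have gs12 : good (s1, s2) (fun y => ramp 4 (f y)).
  split.
  - split; first by move=> y; apply: (@continuous_comp _ _ _ f (ramp 4));
      [exact: cf|exact: ramp_continuous].
    apply: (@compact_supportS _ _ (closure [set y | f y != 0])).
    + exact: closed_closure.
    + by case: ccf.
    + move=> y ny; rewrite (_ : f y = 0); first by apply: ramp0; lra.
      by apply/eqP/negPn/negP => ?; apply: ny; apply: subset_closure.
  - by move=> y; rewrite ramp_ge0 ramp_le1.
  - by move=> y /= /s1f /= /ltW ?; apply: ramp1 => //; lra.
  - move=> y /= ns2; apply: ramp0.
    suff : f y < 1 / 4 by lra.
    by rewrite ltNge; apply/negP => /fs2.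
exists (pickle (s1, s2)); rewrite pickleK /=.
rewrite /Psi; case: pselect => [h|[]]; last by exists (fun y => ramp 4 (f y)).
case: cid => g /= [_ _ g1 g0]; split.
- by move=> y /Cs1; exact: g1.
- by move=> y Uy; apply: g0 => /s2U.
Qed.

End compact_support.

(** * Expectations of bounded measurable functions *)
Section expectation.
Context d (T : measurableType d) (R : realType).
Implicit Types (mu : probability T R) (f g : T -> R).

(** Bounded measurable functions: the class on which every probability
    acts as a positive normalised linear functional. *)
Definition bmf f : Prop :=
  measurable_fun setT f /\ exists M : R, forall x, `|f x| <= M.

Lemma bmf_cst r : bmf (cst r).
Proof. by split=> //; exists `|r|. Qed.

Lemma bmfD f g : bmf f -> bmf g -> bmf (fun x => f x + g x).
Proof.
move=> [mf [M fM]] [mg [N gN]]; split; first exact: measurable_funD.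
by exists (M + N) => x; apply: (le_trans (ler_normD _ _)); exact: lerD.
Qed.

Lemma bmfM f g : bmf f -> bmf g -> bmf (fun x => f x * g x).
Proof.
move=> [mf [M fM]] [mg [N gN]]; split; first exact: measurable_funM.
by exists (M * N) => x; rewrite normrM; exact: ler_pM.
Qed.

Lemma bmfZ r f : bmf f -> bmf (fun x => r * f x).
Proof. by move=> bf; apply: (@bmfM (cst r)) => //; exact: bmf_cst. Qed.

Lemma bmfB f g : bmf f -> bmf g -> bmf (fun x => f x - g x).
Proof.
move=> bf bg; under eq_fun do rewrite -mulN1r.
by apply: bmfD => //; exact: bmfZ.
Qed.

Lemma bmf_norm f : bmf f -> bmf (fun x => `|f x|).
Proof.
move=> [mf [M fM]]; split; first exact: measurableT_comp.
by exists M => x; rewrite normr_id.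
Qed.

Lemma bmf_sum I (s : seq I) (F : I -> T -> R) :
  (forall i, bmf (F i)) -> bmf (fun x => \sum_(i <- s) F i x).
Proof.
move=> bF; elim: s => [|i s ih].
  by under eq_fun do rewrite big_nil; exact: bmf_cst.
by under eq_fun do rewrite big_cons; exact: bmfD.
Qed.

Lemma bmf_integrable mu f : bmf f -> mu.-integrable setT (EFin \o f).
Proof.
move=> [mf [M fM]]; apply: measurable_bounded_integrable => //.
  have : (mu setT < +oo)%E by rewrite probability_setT ltry.
  exact.
by exists M; split; [exact: num_real|move=> N MN x _ /=; apply: le_trans (ltW MN)].
Qed.

Lemma EFin_expectation mu f : bmf f ->
  (\int[mu]_x (f x)%:E)%E = (\int[mu]_x f x)%:E.
Proof.
by move=> bf; rewrite /Rintegral fineK//; apply: integrable_fin_num => //;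
  exact: bmf_integrable.
Qed.

Lemma expect_cst mu r : \int[mu]_x r = r.
Proof.
transitivity (r * fine (mu setT)); first exact: Rintegral_cst.
by rewrite probability_setT mulr1.
Qed.

Lemma expectD mu f g : bmf f -> bmf g ->
  \int[mu]_x (f x + g x) = \int[mu]_x f x + \int[mu]_x g x.
Proof. by move=> bf bg; apply: RintegralD => //; exact: bmf_integrable. Qed.

Lemma expectB mu f g : bmf f -> bmf g ->
  \int[mu]_x (f x - g x) = \int[mu]_x f x - \int[mu]_x g x.
Proof. by move=> bf bg; apply: RintegralB => //; exact: bmf_integrable. Qed.

Lemma expectZ mu r f : bmf f -> \int[mu]_x (r * f x) = r * \int[mu]_x f x.
Proof. by move=> bf; apply: RintegralZl => //; exact: bmf_integrable. Qed.

Lemma expect_sum mu I (s : seq I) (F : I -> T -> R) : (forall i, bmf (F i)) ->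
  \int[mu]_x (\sum_(i <- s) F i x) = \sum_(i <- s) \int[mu]_x F i x.
Proof.
move=> bF; elim: s => [|i s ih].
  by rewrite big_nil; under eq_Rintegral do rewrite big_nil; exact: expect_cst.
rewrite big_cons -ih -expectD//; last exact: bmf_sum.
by apply: eq_Rintegral => x _; rewrite big_cons.
Qed.

Lemma expect_le mu f g : bmf f -> bmf g -> (forall x, f x <= g x) ->
  \int[mu]_x f x <= \int[mu]_x g x.
Proof. by move=> bf bg fg; apply: le_Rintegral => //; exact: bmf_integrable. Qed.

Lemma expect_ge0 mu f : (forall x, 0 <= f x) -> 0 <= \int[mu]_x f x.
Proof. by move=> f0; exact: Rintegral_ge0. Qed.

Lemma expect_abs mu f : bmf f -> `|\int[mu]_x f x| <= \int[mu]_x `|f x|.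
Proof. by move=> bf; apply: le_normr_Rintegral => //; exact: bmf_integrable. Qed.

Lemma expect_abs_le mu f (M : R) : bmf f -> (forall x, `|f x| <= M) ->
  `|\int[mu]_x f x| <= M.
Proof.
move=> bf fM; apply: (le_trans (expect_abs mu bf)).
rewrite -(expect_cst mu M); apply: expect_le fM; first exact: bmf_norm.
exact: bmf_cst.
Qed.

Lemma expect_close mu f g (e : R) : bmf f -> bmf g ->
  (forall x, `|f x - g x| <= e) ->
  `|\int[mu]_x f x - \int[mu]_x g x| <= e.
Proof.
by move=> bf bg fg; rewrite -expectB//; apply: expect_abs_le => //; exact: bmfB.
Qed.

Lemma expect_ge0_le1 mu f : bmf f -> (forall x, 0 <= f x <= 1) ->
  0 <= \int[mu]_x f x <= 1.
Proof.
move=> bf f01; rewrite expect_ge0 => [/=|x]; last by case/andP: (f01 x).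
rewrite -(expect_cst mu 1); apply: expect_le => // [|x].
  exact: bmf_cst.
by case/andP: (f01 x).
Qed.

Lemma bmf_indic (A : set T) : measurable A -> bmf (\1_A).
Proof.
move=> mA; split; first exact: measurable_indic.
by exists 1 => x; rewrite indicE; case: (x \in A) => /=; rewrite ?normr0 ?normr1.
Qed.

Lemma expect_indic mu (A : set T) : measurable A -> \int[mu]_x \1_A x = fine (mu A).
Proof. by move=> mA; rewrite /Rintegral integral_indic// setIT. Qed.

Lemma measure_to_probability (mu : {measure set T -> \bar R}) :
  mu setT = 1%E -> exists P : probability T R, forall A, P A = mu A.
Proof.
move=> mu1; exists (mnormalize mu (\d_point : probability T R)) => A.
transitivity (if ((mu setT == 0) || (mu setT == +oo))%E then \d_point A
     else (mu A * (fine (mu setT))^-1%:E)%E).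
  by rewrite /= /mnormalize; case: ifP.
by rewrite mu1/= onee_eq0/= invr1 mule1.
Qed.

Import HBNNSimple.

(** The integral is defined for any set function and evaluates it at preimages
under simple functions only.  This relates integrals against averages of Dirac
masses, given as mere set functions, to integrals against probabilities. *)
Lemma integral_eq_set_fun (m1 m2 : set T -> \bar R) (f : T -> \bar R) :
  (forall A, measurable A -> m1 A = m2 A) ->
  (\int[m1]_x f x = \int[m2]_x f x)%E.
Proof.
move=> m12; rewrite /integral.
have sI (h : {nnsfun T >-> R}) : sintegral m1 h = sintegral m2 h.
  by apply: eq_fsbigr => r _; rewrite m12//; exact: measurable_sfunP.
by congr (_ - _)%E; congr ereal_sup; apply/seteqP; split => _ [h hf <-];
  exists h.
Qed.

End expectation.

Section pushforward_expectation.
Context d d' (T : measurableType d) (U : measurableType d') (R : realType).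

Lemma bmf_comp (phi : T -> U) (f : U -> R) :
  measurable_fun setT phi -> bmf f -> bmf (fun x => f (phi x)).
Proof.
move=> mphi [mf [M fM]]; split; last by exists M.
exact: measurableT_comp.
Qed.

Lemma pushforward_probability (P : probability T R) (phi : T -> U) :
  measurable_fun setT phi ->
  exists Q : probability U R, (forall A, Q A = P (phi @^-1` A)) /\
    forall f : U -> R, bmf f -> \int[Q]_x f x = \int[P]_x f (phi x).
Proof.
move=> mphi.
pose phim : {mfun T >-> U} := HB.pack phi (isMeasurableFun.Build _ _ _ _ _ mphi).
exists (distribution P phim); split=> // f bf.
rewrite /Rintegral; congr fine.
have [mf [M fM]] := bf.
rewrite integral_pushforward//=; first exact/measurable_EFinP.
exact: (bmf_integrable P (bmf_comp mphi bf)).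
Qed.

End pushforward_expectation.

(** * Weak-* convergence of probabilities *)
Section bounded_continuous.
Context (R : realType).

Definition bcont (X : topologicalType) (f : X -> R) : Prop :=
  continuous f /\ exists M : R, forall x, `|f x| <= M.

Lemma bcont01 (X : topologicalType) (f : X -> R) :
  continuous f -> (forall y, 0 <= f y <= 1) -> bcont f.
Proof.
move=> cf f01; split=> //; exists 1 => x.
by have /andP[f0 f1] := f01 x; rewrite ger0_norm.
Qed.

Lemma open_borel_measurable (X : ptopologicalType) (U : set X) :
  open U -> measurable (U : set (borel X)).
Proof. by move=> oU; apply: sub_sigma_algebra. Qed.

Lemma closed_borel_measurable (X : ptopologicalType) (U : set X) :
  closed U -> measurable (U : set (borel X)).
Proof.
move=> cU; rewrite -(setCK U); apply: measurableC.
by apply: open_borel_measurable; exact: closed_openC.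
Qed.

Lemma continuous_borel_measurable (X Y : ptopologicalType) (f : X -> Y) :
  continuous f -> measurable_fun setT (f : borel X -> borel Y).
Proof.
move=> cf; apply: (@measurability _ _ (borel X) (borel Y) _ _ (@open Y)) => //.
move=> _ [U oU <-]; rewrite setTI; apply: open_borel_measurable.
by apply: open_comp => // x _; exact: cf.
Qed.

Lemma measurable_fun_open (d : measure_display) (T : measurableType d)
    (f : T -> R) :
  (forall U : set R, open U -> measurable (f @^-1` U)) -> measurable_fun setT f.
Proof.
move=> fo; apply: (measurability _ (RGenOpens.measurableE R)).
move=> _ [_ [a [b ->] <-]]; rewrite setTI; apply: fo.
exact: interval_open.
Qed.

Lemma continuous_measurable_real (X : ptopologicalType) (f : X -> R) :
  continuous f -> measurable_fun setT (f : borel X -> R).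
Proof.
move=> cf; apply: measurable_fun_open => U oU; apply: open_borel_measurable.
by apply: open_comp => // x _; exact: cf.
Qed.

Lemma bcont_bmf (X : ptopologicalType) (f : X -> R) :
  bcont f -> bmf (f : borel X -> R).
Proof. by move=> [cf bf]; split=> //; exact: continuous_measurable_real. Qed.

Lemma Cc_bcont (X : topologicalType) (f : X -> R) : Cc f -> bcont f.
Proof.
move=> [cf kf]; split=> //.
suff [M M0 fM] : exists2 M : R, 0 <= M &
    forall x, closure [set y | f y != 0] x -> `|f x| <= M.
  exists M => x; have [->|fx] := eqVneq (f x) 0; first by rewrite normr0.
  by apply: fM; exact: subset_closure.
apply: (@compact_set_ind _ (fun B => exists2 M : R, 0 <= M &
  forall x, B x -> `|f x| <= M)); last exact: kf.
- by exists 0.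
- move=> A B [M M0 fM] [N N0 gN]; exists (Num.max M N).
    by rewrite le_max M0.
  by move=> x [/fM|/gN] fx; rewrite le_max fx ?orbT.
- by move=> A B AB [M M0 fM]; exists M => // x /AB/fM.
- move=> x _; exists [set y | `|f x - f y| < 1].
    by have /cvgrPdist_lt/(_ _ ltr01) := cf x.
  exists (`|f x| + 1); first by rewrite addr_ge0.
  move=> y /= /ltW fxy; rewrite -[f y](subrK (f x)) addrC.
  by apply: (le_trans (ler_normD _ _)); rewrite lerD2l distrC.
Qed.

Lemma Cc_bmf (X : ptopologicalType) (f : X -> R) :
  Cc f -> bmf (f : borel X -> R).
Proof. by move=> /Cc_bcont/bcont_bmf. Qed.

Lemma bcont_sum (X : topologicalType) I (s : seq I) (F : I -> X -> R) :
  (forall i, bcont (F i)) -> bcont (fun y => \sum_(i <- s) F i y).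
Proof.
move=> bF; elim: s => [|i s [cs [M sM]]].
  under eq_fun do rewrite big_nil.
  by split; [exact: cst_continuous|exists 0 => x; rewrite normr0].
under eq_fun do rewrite big_cons.
have [ci [N iN]] := bF i; split.
  by move=> y; apply: continuousD; [exact: ci|exact: cs].
exists (N + M) => x; apply: (le_trans (ler_normD _ _)); exact: lerD.
Qed.

Lemma bcont_comp (X Y : topologicalType) (g : X -> Y) (f : Y -> R) :
  continuous g -> bcont f -> bcont (fun x => f (g x)).
Proof.
move=> cg [cf [M fM]]; split; last by exists M.
by move=> x; apply: (@continuous_comp _ _ _ g f); [exact: cg|exact: cf].
Qed.

(** All the terms [p k] are determined to be [1] or [0] except the one with
[k < u < k + 1]. *)
Lemma layer_sum (n : nat) (p : nat -> R) (u : R) :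
  (forall k, 0 <= p k <= 1) ->
  (forall k, (k.+1)%:R <= u -> p k = 1) -> (forall k, u <= k%:R -> p k = 0) ->
  0 <= u <= n%:R -> `|u - \sum_(k < n) p k| <= 1.
Proof.
move=> p01 p1 p0 /andP[u0 un].
suff : (n%:R <= u -> \sum_(k < n) p k = n%:R) /\
    (u <= n%:R -> `|u - \sum_(k < n) p k| <= 1) by case=> _; exact.
elim: n {un} => [|n [ih1 ih2]].
  split; rewrite big_ord0 // => u0'.
  by rewrite (_ : u = 0) ?subr0 ?normr0//; apply/eqP; rewrite eq_le u0'.
split; rewrite big_ord_recr /= => un.
  rewrite p1// ih1 ?natr1//; apply: le_trans un.
  by rewrite ler_nat.
have [un'|nu] := leP u n%:R.
  by rewrite p0// addr0; exact: ih2.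
rewrite (ih1 (ltW nu)); have /andP[pn0 pn1] := p01 n.
rewrite -natr1 in un.
by rewrite ler_norml; lra.
Qed.

(** Sums over superlevel sets.  The functions [phi k] may be indicators of
[f >= (k + 1) / n], or continuous functions squeezed between the indicators of
[f >= (k + 1) / n] and of [f > k / n]: the former occur in [mixing_function], the
latter in [test_family_cvg]. *)
Lemma layer_approx (T : Type) (f : T -> R) (n : nat) (phi : nat -> T -> R) :
  (0 < n)%N -> (forall y, 0 <= f y <= 1) -> (forall k y, 0 <= phi k y <= 1) ->
  (forall k y, (k.+1)%:R / n%:R <= f y -> phi k y = 1) ->
  (forall k y, f y <= k%:R / n%:R -> phi k y = 0) ->
  forall y, `|f y - n%:R^-1 * \sum_(k < n) phi k y| <= n%:R^-1.
Proof.
move=> n0 f01 phi01 phi1 phi0 y.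
have n0' : 0 < n%:R :> R by rewrite ltr0n.
have -> : f y - n%:R^-1 * \sum_(k < n) phi k y =
    n%:R^-1 * (n%:R * f y - \sum_(k < n) phi k y).
  by rewrite mulrBr mulKf// gt_eqF.
rewrite normrM ger0_norm ?invr_ge0 ?ler0n//.
rewrite ler_piMr ?invr_ge0 ?ler0n//.
apply: (@layer_sum n (phi^~ y)) => //.
- by move=> k ku; apply: phi1; rewrite ler_pdivrMr// mulrC.
- by move=> k ku; apply: phi0; rewrite ler_pdivlMr// mulrC.
- have /andP[? ?] := f01 y; rewrite mulr_ge0//=.
  by rewrite ler_piMr.
Qed.

Section convergence.
Context (X : ptopologicalType) (Phi : nat -> X -> R) (PhiP : test_family Phi).
Context (J : Type) (F : set_system J) {FF : Filter F}.
Context (mu : J -> probability (borel X) R) (m : probability (borel X) R).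

Let conv (f : X -> R) : Prop :=
  bmf (f : borel X -> R) /\ \int[mu i]_y f y @[i --> F] --> \int[m]_y f y.

Let conv_unif f : bmf (f : borel X -> R) ->
  (forall e : R, 0 < e -> exists2 g, conv g & forall y, `|f y - g y| <= e) ->
  conv f.
Proof.
move=> bf fg; split=> //; apply/cvgrPdist_le => e e0.
have e30 : 0 < e / 3 by rewrite divr_gt0.
have [g [bg /cvgrPdist_le /(_ _ e30) cg] fge] := fg _ e30.
apply: filterS cg => i cgi.
have := expect_close m bf bg fge.
have := expect_close (mu i) bf bg fge.
rewrite !ler_distl => /andP[? ?] /andP[? ?].
move: cgi; rewrite ler_distl => /andP[? ?].
by lra.
Qed.

Let conv_lin f g (a b : R) : conv f -> conv g -> conv (fun y => a * f y + b * g y).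
Proof.
move=> [bf cf] [bg cg]; split; first by apply: bmfD; exact: bmfZ.
rewrite expectD; [|exact: bmfZ|exact: bmfZ]; rewrite !expectZ//.
under eq_fun => i.
  rewrite expectD; [|exact: bmfZ|exact: bmfZ]; rewrite !expectZ//.
  over.
by apply: cvgD; apply: cvgM => //; exact: cvg_cst.
Qed.

Let conv_cst0 : conv (cst 0).
Proof.
split; first exact: bmf_cst.
rewrite expect_cst; under eq_fun do rewrite expect_cst.
exact: cvg_cst.
Qed.

Let conv_ext f g : f =1 g -> conv f -> conv g.
Proof. by move=> /funext ->. Qed.

Let conv_sum (s : seq nat) (G : nat -> X -> R) :
  (forall k, conv (G k)) -> conv (fun y => \sum_(k <- s) G k y).
Proof.
move=> cG; elim: s => [|k s ih].
  by apply: conv_ext conv_cst0 => y; rewrite big_nil.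
apply: conv_ext (conv_lin 1 1 (cG k) ih) => y.
by rewrite big_cons !mul1r.
Qed.

(** By [layer_approx] the functions with values in [[0, 1]] are uniform limits of
combinations of members of the family, and convergence against probabilities is
stable under combinations and uniform limits.  The other functions are handled
by scaling their positive and negative parts. *)
Lemma test_family_cvg :
  (forall n, \int[mu i]_y Phi n y @[i --> F] --> \int[m]_y Phi n y) ->
  forall f, Cc f -> \int[mu i]_y f y @[i --> F] --> \int[m]_y f y.
Proof.
move=> cPhi; have [PhiC PhiU] := PhiP.
have cPhi' n : conv (Phi n) by split=> //; apply: Cc_bmf; case: (PhiC n).
have step1 f : Cc f -> (forall y, 0 <= f y <= 1) -> conv f.
  move=> ccf f01; apply: conv_unif => [|e e0]; first exact: Cc_bmf.
  have [n n0 ne] : exists2 n : nat, (0 < n)%N & n%:R^-1 <= e.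
    exists (Num.truncn e^-1).+1 => //; rewrite invf_ple ?posrE//.
    exact/ltW/truncnS_gt.
  have n0' : 0 < n%:R :> R by rewrite ltr0n.
  have ex k : exists j, (forall y, (k.+1)%:R / n%:R <= f y -> Phi j y = 1) /\
      (forall y, f y <= k%:R / n%:R -> Phi j y = 0).
    have cf : continuous f by case: ccf.
    have fk : [set y | (k.+1)%:R / n%:R <= f y] `<=` [set y | k%:R / n%:R < f y].
      move=> y /=; apply: lt_le_trans.
      by rewrite ltr_pM2r ?invr_gt0// ltr_nat.
    have [j [j1 j0]] := PhiU _ _
      (compact_ge_Cc ccf (divr_gt0 (ltr0Sn _ _) n0'))
      (@open_comp _ _ f [set z | k%:R / n%:R < z]
        (fun x _ => cf x) (open_gt (y := k%:R / n%:R))) fk.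
    by exists j; split=> // y fy; apply: j0 => /=; apply/negP; rewrite -leNgt.
  have /choice[j jP] := ex.
  exists (fun y => n%:R^-1 * \sum_(k <- iota 0 n) Phi (j k) y).
    have cS := @conv_sum (iota 0 n) (fun k => Phi (j k)) (fun k => cPhi' (j k)).
    by apply: conv_ext (conv_lin n%:R^-1 0 cS conv_cst0) => y; rewrite mul0r addr0.
  move=> y; apply: le_trans ne.
  have -> : \sum_(k <- iota 0 n) Phi (j k) y = \sum_(k < n) Phi (j k) y.
    by rewrite -(big_mkord xpredT (fun k => Phi (j k) y)) /index_iota subn0.
  apply: (@layer_approx _ f n (fun k => Phi (j k))) => //.
  - by move=> k z; have [_] := PhiC (j k); exact.
  - by move=> k z; exact: (jP k).1.
  - by move=> k z; exact: (jP k).2.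
move=> f ccf.
suff [] : conv f by [].
have [cf [M fM]] := Cc_bcont ccf.
pose N := `|M| + 1.
have N0 : 0 < N by rewrite ltr_wpDl.
have fN y : `|f y| <= N.
  by apply: (le_trans (fM y)); rewrite (le_trans (ler_norm M))// lerDl.
have part s : `|s| <= 1 -> conv (fun y => Num.max 0 (s * f y / N)).
  move=> s1; apply: step1.
    apply: (@Cc_comp2 _ _ f f (fun u v => Num.max 0 (s * u / N))) => //.
      by rewrite mulr0 mul0r maxxx.
    move=> _ _ y /=.
    apply: (@continuous_max R _ (cst 0) (fun y => s * f y / N) y).
      exact: cst_continuous.
    apply: (@continuousM _ _ (fun y => s * f y) (cst N^-1)); last exact: cst_continuous.
    by apply: (@continuousM _ _ (cst s) f); [exact: cst_continuous|exact: cf].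
  move=> y; rewrite le_max lexx/= ge_max ler01/= ler_pdivrMr// mul1r.
  apply: (le_trans (ler_norm _)); rewrite normrM.
  by apply: le_trans (fN y); rewrite ler_piMl.
have p1 := part 1 _; have p2 := part (-1) _.
rewrite normrN normr1 in p1 p2.
apply: conv_ext (conv_lin N (- N) (p1 (lexx _)) (p2 (lexx _))) => y.
rewrite mul1r mulN1r mulNr.
have [f0|f0] := leP 0 (f y).
  rewrite (max_r (x := 0) (y := f y / N)) ?divr_ge0 ?(ltW N0)//.
  rewrite (max_l (x := 0) (y := - f y / N)); last first.
    by rewrite mulNr oppr_le0 divr_ge0// (ltW N0).
  by rewrite mulr0 oppr0 addr0 mulrC divfK// gt_eqF.
rewrite (max_l (x := 0) (y := f y / N)); last first.
  by rewrite ler_pdivrMr// mul0r ltW.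
rewrite (max_r (x := 0) (y := - f y / N)); last first.
  by apply: divr_ge0; [rewrite oppr_ge0; exact: ltW|exact: ltW].
by rewrite mulr0 add0r mulNr mulrN opprK mulrC divfK// gt_eqF.
Qed.

(** The maxima of the first [n] functions of the family increase to [1], because
each point is a compact set. *)
Lemma compact_support_tight (e : R) : 0 < e ->
  exists chi : X -> R, [/\ Cc chi, forall y, 0 <= chi y <= 1 &
    1 - e <= \int[m]_y chi y].
Proof.
move=> e0; have [PhiC PhiU] := PhiP.
pose psi := fix psi n : X -> R :=
  if n is n'.+1 then (fun y => Num.max (psi n' y) (Phi n' y)) else cst 0.
have psiP n : Cc (psi n) /\ forall y, 0 <= psi n y <= 1.
  elim: n => [|n [ccn n01]] /=.
    split; last by move=> y; rewrite lexx ler01.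
    split; first exact: cst_continuous.
    apply: (@compact_supportS _ _ _ set0) => //; first exact: closed0.
    exact: compact0.
  have [cP P01] := PhiC n; split.
    apply: Cc_comp2 ccn cP; first by rewrite maxxx.
    by move=> cf cg y; apply: continuous_max; [exact: cf|exact: cg].
  move=> y; have /andP[? ?] := n01 y; have /andP[? ?] := P01 y.
  by rewrite le_max ge_max; apply/andP; split; [apply/orP; left|apply/andP].
pose A n : set (borel X) := [set y | 1 <= psi n y].
have mA n : measurable (A n).
  apply: (@closed_borel_measurable X); have [[cn _] _] := psiP n.
  exact: (@preimage_closed _ _ (psi n) [set z | 1 <= z] (fun x _ => cn x)
    (closed_ge (y := 1))).
have AT : \bigcup_n A n = setT.
  apply/seteqP; split=> // y _.
  have [j [j1 _]] := PhiU [set y] setT (@compact_set1 _ y) openT (fun _ _ => I).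
  by exists j.+1 => //; rewrite /A /= le_max j1// lexx orbT.
have ndA : nondecreasing_seq A.
  apply/nondecreasing_seqP => n; apply/subsetPset => y.
  by rewrite /A /= le_max => ->.
have cA : m \o A @ \oo --> m setT.
  rewrite -AT; apply: (nondecreasing_cvg_mu (mu := m)) => //.
  by rewrite AT; exact: measurableT.
have mT : m setT = 1%E by exact: probability_setT.
move: cA; rewrite mT.
move=> /fine_cvg /cvgrPdist_le /(_ _ e0) [N _ /(_ N (leqnn N)) mN].
exists (psi N); have [ccN N01] := psiP N; split=> //.
have : \int[m]_y \1_(A N) y <= \int[m]_y psi N y.
  apply: expect_le => [||y]; first exact: bmf_indic.
    exact: Cc_bmf.
  rewrite indicE; have [|] := boolP (y \in A N); first by rewrite inE.
  by have /andP[] := N01 y.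
rewrite expect_indic//; apply: le_trans.
have mN' : `|1 - fine (m (A N))| <= e by exact: mN.
by move: mN'; rewrite ler_distl => /andP[? ?]; lra.
Qed.

(** Multiply [f] by a cutoff [chi] of almost full mass for [m]; the mass of
[1 - chi] for [mu i] is controlled since [chi] is itself a test function and all
the masses are [1]. *)
Lemma Cc_cvg_bcont :
  (forall f, Cc f -> \int[mu i]_y f y @[i --> F] --> \int[m]_y f y) ->
  forall f, bcont f -> \int[mu i]_y f y @[i --> F] --> \int[m]_y f y.
Proof.
move=> cC f [cf [M fM]].
pose N := `|M| + 1.
have N0 : 0 < N by rewrite ltr_wpDl.
have fN y : `|f y| <= N.
  by apply: (le_trans (fM y)); rewrite (le_trans (ler_norm M))// lerDl.
have bf : bmf (f : borel X -> R) by apply: bcont_bmf; split=> //; exists M.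
apply/cvgrPdist_le => e e0.
pose e' := e / (4 * N).
have e'0 : 0 < e' by rewrite divr_gt0// mulr_gt0.
have [chi [cchi chi01 mchi]] := compact_support_tight e'0.
have cchi' : continuous chi by case: cchi.
have bchi := Cc_bmf cchi.
have cfchi : Cc (fun y => f y * chi y).
  split; first by move=> y; apply: continuousM; [exact: cf|exact: cchi'].
  apply: (@compact_supportS _ _ _ (closure [set y | chi y != 0])).
  + exact: closed_closure.
  + by case: cchi.
  + move=> y ny; rewrite (_ : chi y = 0) ?mulr0//.
    by apply/eqP/negPn/negP => ?; apply: ny; apply: subset_closure.
have est (P : probability (borel X) R) :
    `|\int[P]_y f y - \int[P]_y (f y * chi y)| <= N * (1 - \int[P]_y chi y).
  rewrite -expectB//; last exact: Cc_bmf.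
  apply: (le_trans (expect_abs _ (bmfB bf (Cc_bmf cfchi)))).
  have -> : N * (1 - \int[P]_y chi y) = \int[P]_y (N * (1 - chi y)).
    rewrite expectZ ?expectB ?expect_cst//; first exact: bmf_cst.
    by apply: bmfB => //; exact: bmf_cst.
  apply: expect_le.
  - by apply: bmf_norm; apply: bmfB => //; exact: Cc_bmf.
  - by apply: bmfZ; apply: bmfB => //; exact: bmf_cst.
  - move=> y; have /andP[? ?] := chi01 y.
    rewrite -{1}[f y]mulr1 -mulrBr normrM ler_pM//.
    by rewrite ger0_norm// subr_ge0.
have e40 : 0 < e / 4 by rewrite divr_gt0.
have /cvgrPdist_le /(_ _ e40) c1 := cC _ cfchi.
have /cvgrPdist_le /(_ _ e'0) c2 := cC _ cchi.
apply: filterS2 c1 c2 => i c1 c2.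
have Ne' : N * e' = e / 4.
  by rewrite /e'; field; rewrite gt_eqF.
have : N * (1 - \int[mu i]_y chi y) <= N * (2 * e').
  rewrite ler_pM2l//; move: c2; rewrite ler_distl => /andP[? ?].
  by lra.
have : N * (1 - \int[m]_y chi y) <= N * e'.
  by rewrite ler_pM2l//; lra.
move: (est m) (est (mu i)) c1; rewrite !ler_distl.
by move=> /andP[? ?] /andP[? ?] /andP[? ?]; lra.
Qed.

Lemma weak_star_cvgP (nu_ : J -> set (borel X) -> \bar R) :
  (\forall i \near F, forall A, measurable A -> nu_ i A = mu i A) ->
  weak_star_cvg F nu_ m <->
  (forall f, Cc f -> \int[mu i]_y f y @[i --> F] --> \int[m]_y f y).
Proof.
move=> numu; have key f (bf : bmf (f : borel X -> R)) :
    \forall i \near F, (\int[nu_ i]_y (f y)%:E)%E = (\int[mu i]_y f y)%:E.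
  apply: filterS numu => i numu.
  by rewrite (integral_eq_set_fun _ numu) EFin_expectation.
split=> [cE f [cf kf]|cR f cf kf].
  have bf : bmf (f : borel X -> R) by apply: Cc_bmf.
  have := cE f cf kf; rewrite (EFin_expectation _ bf) => /fine_cvgP[_] c.
  apply: cvg_trans c; apply: near_eq_cvg.
  by apply: filterS (key f bf) => i /= ->.
have bf : bmf (f : borel X -> R) by apply: Cc_bmf.
rewrite (EFin_expectation _ bf); apply: cvg_EFin.
  by apply: filterS (key f bf) => i ->.
apply: cvg_trans (cR f (conj cf kf)); apply: near_eq_cvg.
by apply: filterS (key f bf) => i /= ->.
Qed.

End convergence.
End bounded_continuous.

(** * Product spaces and Fubini's theorem *)
Section product_expectation.
Context (R : realType).

(** Second countability makes an open set of the product a countable union of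
boxes; without it the product of the Borel sigma-algebras could be too small. *)
Lemma open_prod_borel_measurable (X Y : ptopologicalType) (U : set (X * Y)) :
  @second_countable X -> @second_countable Y -> open U ->
  measurable (U : set (borel X * borel Y)%type).
Proof.
move=> /countable_basis_sequence[V [oV bV]] /countable_basis_sequence[W [oW bW]] oU.
have -> : U = \bigcup_i \bigcup_(j in [set j | V i `*` W j `<=` U]) (V i `*` W j).
  apply/seteqP; split=> [[x y] Uxy|z [i _ [j VWU VWz]]]; last exact: VWU.
  have : nbhs (x, y) U by exact: open_nbhs_nbhs.
  move=> [[A B] /= [Ax By] ABU].
  have [i Vix ViA] := bV _ _ Ax; have [j Wjy WjB] := bW _ _ By.
  exists i => //; exists j => //= z [? ?]; apply: ABU; split => /=.
    exact: ViA.
  exact: WjB.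
apply: bigcupT_measurable => i; apply: bigcup_measurable => j _.
by apply: measurableX; exact: open_borel_measurable.
Qed.

Lemma bcont_prod_bmf (X Y : ptopologicalType) (F : X * Y -> R) :
  @second_countable X -> @second_countable Y -> bcont F ->
  bmf (F : (borel X * borel Y)%type -> R).
Proof.
move=> sX sY [cF bF]; split=> //; apply: measurable_fun_open => U oU.
apply: open_prod_borel_measurable => //.
by apply: open_comp => // x _; exact: cF.
Qed.

Context d1 d2 (T1 : measurableType d1) (T2 : measurableType d2).
Context (P1 : probability T1 R) (P2 : probability T2 R).
Variable F : (T1 * T2)%type -> R.
Hypothesis bF : bmf F.

Lemma bmf_section1 x : bmf (fun y => F (x, y)).
Proof.
have [mF [M FM]] := bF; split; last by exists M.
exact: measurable_fun_pair2.
Qed.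

Lemma bmf_marginal : bmf (fun x => \int[P2]_y F (x, y)).
Proof.
have [mF [M FM]] := bF; split; last first.
  by exists M => x; apply: expect_abs_le => //; exact: bmf_section1.
have mG : measurable_fun setT (fun z => (F z + M)%:E).
  by apply/measurable_EFinP; apply: measurable_funD.
have G0 z : (0 <= (F z + M)%:E)%E.
  by rewrite lee_fin; have := FM z; rewrite ler_norml => /andP[? _]; lra.
have := @measurable_fun_fubini_tonelli_F _ _ _ _ _ P2 _ mG G0.
have -> : fubini_F P2 (fun z => (F z + M)%:E) =
    EFin \o (fun x => \int[P2]_y F (x, y) + M).
  apply/funext => x; rewrite /fubini_F /=.
  rewrite (EFin_expectation P2 (bmfD (bmf_section1 x) (bmf_cst _ _))).
  by rewrite expectD ?expect_cst//; [exact: bmf_section1|exact: bmf_cst].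
move=> /measurable_EFinP m1.
have -> : (fun x => \int[P2]_y F (x, y)) =
    (fun x => (\int[P2]_y F (x, y) + M) + - M).
  by apply/funext => x; rewrite addrK.
by apply: measurable_funD.
Qed.

Lemma expect_fubini_section :
  (\int[P1]_x \int[P2]_y F (x, y))%:E =
  (\int[P1]_x \int[P2]_y (F (x, y))%:E)%E.
Proof.
under [RHS]eq_integral do rewrite (EFin_expectation P2 (bmf_section1 _)).
by rewrite EFin_expectation//; exact: bmf_marginal.
Qed.

End product_expectation.

Lemma expect_fubini (R : realType) d1 d2 (T1 : measurableType d1)
    (T2 : measurableType d2) (P1 : probability T1 R) (P2 : probability T2 R)
    (F : (T1 * T2)%type -> R) : bmf F ->
  \int[P1]_x \int[P2]_y F (x, y) = \int[P2]_y \int[P1]_x F (x, y).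
Proof.
move=> bF; apply: EFin_inj; rewrite expect_fubini_section//.
have bF' : bmf (fun z : (T2 * T1)%type => F (z.2, z.1)).
  by apply: (bmf_comp (phi := fun z : (T2 * T1)%type => (z.2, z.1))) => //;
    exact: measurable_swap.
have := expect_fubini_section P2 P1 bF'; rewrite /= => ->.
have [mF [M FM]] := bF.
apply: (@Fubini _ _ T1 T2 R P1 P2 (EFin \o F)); apply/integrableP; split.
  exact/measurable_EFinP.
apply: (@le_lt_trans _ _ (\int[P1 \x P2]_z (cst M%:E z))%E).
  apply: ge0_le_integral => //.
  - by apply: measurableT_comp => //; exact/measurable_EFinP.
  - by move=> z _; rewrite /= lee_fin (le_trans _ (FM z)).
have PT : (P1 \x P2)%E setT = 1%E by exact: probability_setT.
have -> : (\int[P1 \x P2]_z (cst M%:E z) = M%:E * (P1 \x P2) setT)%E.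
  exact: integral_cst.
by rewrite PT mule1 ltry.
Qed.

Section support.
Context d (T : measurableType d) (R : realType).

Lemma expect_abs_le_on (mu : probability T R) (f : T -> R) (L : set T) (e : R) :
  measurable L -> mu L = 1%E -> 0 <= e -> bmf f ->
  (forall x, L x -> `|f x| <= e) -> `|\int[mu]_x f x| <= e.
Proof.
move=> mL muL e0 bf fe; have [mf [M fM]] := bf.
have M0 : 0 <= M by apply: le_trans (fM point).
apply: (le_trans (expect_abs mu bf)).
apply: (@le_trans _ _ (\int[mu]_x (e + M * (1 - \1_L x)))).
  apply: expect_le; first exact: bmf_norm.
    apply: bmfD; first exact: bmf_cst.
    apply: bmfZ; apply: bmfB; first exact: bmf_cst.
    exact: bmf_indic.
  move=> x; rewrite indicE; have [|] := boolP (x \in L).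
    by rewrite inE => /fe; rewrite subrr mulr0 addr0.
  by move=> _; rewrite subr0 mulr1; apply: (le_trans (fM x)); rewrite lerDr.
rewrite expectD ?expectZ ?expectB ?expect_cst ?expect_indic//.
- have -> : fine (mu L) = 1 by rewrite muL.
  by rewrite subrr mulr0 addr0.
- exact: bmf_cst.
- exact: bmf_indic.
- by apply: bmfB; [exact: bmf_cst|exact: bmf_indic].
- exact: bmf_cst.
- by apply: bmfZ; apply: bmfB; [exact: bmf_cst|exact: bmf_indic].
Qed.

End support.

(** * The action, the flow and the sets [a_[s, t] K] *)
Section group_continuity.
Context (R : realType) (X : ptopologicalType) (H : topologicalGroupType).
Context (act : H -> X -> X) (act_cont : continuous_action act).

Lemma continuous_pair (T U V : topologicalType) (f : T -> U) (g : T -> V) :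
  continuous f -> continuous g -> continuous (fun t => (f t, g t)).
Proof. by move=> cf cg t; apply: cvg_pair; [exact: cf|exact: cg]. Qed.

Lemma continuous_mulg (T : topologicalType) (f g : T -> H) :
  continuous f -> continuous g -> continuous (fun t => (f t * g t)%g).
Proof.
move=> cf cg t; apply: (@continuous_comp _ _ _ (fun t => (f t, g t))
  (fun z : H * H => (z.1 * z.2)%g)); first exact: continuous_pair.
exact: mulg_continuous.
Qed.

Lemma continuous_invg (T : topologicalType) (f : T -> H) :
  continuous f -> continuous (fun t => ((f t)^-1)%g).
Proof.
move=> cf t; apply: (@continuous_comp _ _ _ f (fun g : H => (g^-1)%g)).
  exact: cf.
exact: invg_continuous.
Qed.

Lemma continuous_act (T : topologicalType) (f : T -> H) (g : T -> X) :
  continuous f -> continuous g -> continuous (fun t => act (f t) (g t)).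
Proof.
have [_ _ ca] := act_cont.
move=> cf cg t; apply: (@continuous_comp _ _ _ (fun t => (f t, g t))
  (fun z : H * X => act z.1 z.2)); first exact: continuous_pair.
exact: ca.
Qed.

Lemma act_continuous h : continuous (act h).
Proof. by apply: continuous_act; [exact: cst_continuous|move=> y]. Qed.

Lemma act1 y : act 1%g y = y.
Proof. by case: act_cont. Qed.

Lemma actM g h y : act (g * h)%g y = act g (act h y).
Proof. by case: act_cont. Qed.

End group_continuity.

Section strips.
Context (R : realType) (H : topologicalGroupType) (a : R -> H) (K : set H).

(** The support of [nu] is in [strip c d].  These sets are compact, and multiply
and invert like the intervals that index them; they record all that is needed
about the elements met by the walk. *)
Definition strip (s t : R) : set H :=
  [set (a u * k)%g | u in `[s, t] & k in K].

Hypothesis a_sub : one_parameter_subgroup a.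
Hypothesis K_sub : compact_subgroup K.
Hypothesis K_comm : forall t k, K k -> (a t * k)%g = (k * a t)%g.

Lemma flowD s t : a (s + t) = (a s * a t)%g.
Proof. by case: a_sub. Qed.

Lemma flow0 : a 0 = 1%g.
Proof. by apply: (mulIg (a 0)); rewrite mul1g -flowD addr0. Qed.

Lemma flowN t : a (- t) = ((a t)^-1)%g.
Proof. by apply: (mulIg (a t)); rewrite mulVg -flowD addNr flow0. Qed.

Lemma stripI s t u k : s <= u <= t -> K k -> strip s t (a u * k)%g.
Proof. by move=> sut Kk; exists u; [rewrite /= in_itv|exists k]. Qed.

Lemma stripP s t h : strip s t h ->
  exists u k, [/\ s <= u <= t, K k & h = (a u * k)%g].
Proof. by move=> [u + [k Kk <-]]; rewrite /= in_itv /= => sut; exists u, k. Qed.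

Lemma strip_mul s t s' t' h h' : strip s t h -> strip s' t' h' ->
  strip (s + s') (t + t') (h * h')%g.
Proof.
have [_ _ KM _] := K_sub.
move=> /stripP[u [k [/andP[su ut] Kk ->]]] /stripP[u' [k' [/andP[su' ut'] Kk' ->]]].
rewrite -mulgA (mulgA k) -K_comm// -(mulgA (a u')) mulgA -flowD.
by apply: stripI; [rewrite !lerD|exact: KM].
Qed.

Lemma strip_inv s t h : strip s t h -> strip (- t) (- s) (h^-1)%g.
Proof.
have [_ _ _ KV] := K_sub.
move=> /stripP[u [k [/andP[su ut] Kk ->]]].
have -> : ((a u * k)^-1)%g = (a (- u) * k^-1)%g.
  rewrite K_comm//; apply: (mulIg (k * a u)%g); rewrite mulVg flowN.
  have KVk := KV _ Kk.
  by rewrite -K_comm// mulgA -(mulgA _ _ (a u)) -K_comm// !mulgA mulVg mul1g mulVg.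
by apply: stripI; [rewrite !lerN2 ut|exact: KV].
Qed.

Lemma strip0 k : K k -> strip 0 0 k.
Proof. by move=> Kk; rewrite -[k]mul1g -flow0; apply: stripI => //; rewrite lexx. Qed.

Lemma strip_compact s t : compact (strip s t).
Proof.
have [cK _ _ _] := K_sub; have [ca _] := a_sub.
have -> : strip s t = (fun z : R * H => (a z.1 * z.2)%g) @` (`[s, t] `*` K).
  apply/seteqP; split=> [_ [u su [k Kk <-]]|_ [[u k] [/= su Kk] <-]].
    by exists (u, k).
  by exists u => //; exists k.
apply: continuous_compact; last first.
  by apply: compact_setX => //; exact: segment_compact.
apply: continuous_subspaceT.
apply: (@continuous_mulg _ _ (fun z : R * H => a z.1) (fun z : R * H => z.2)).
  by move=> z; apply: (@continuous_comp _ _ _ fst a); [exact: cvg_fst|exact: ca].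
by move=> z; exact: cvg_snd.
Qed.

Lemma strip_comm s t h : strip s t h -> forall r, (a r * h)%g = (h * a r)%g.
Proof.
move=> /stripP[u [k [_ Kk ->]]] r.
by rewrite mulgA -flowD addrC flowD -!mulgA (K_comm r Kk).
Qed.

Hypothesis a_infty : a t @[t --> +oo] --> at_infinity H.

(** [a t * k] in [C] would put [a t] in the compact set [C * K]. *)
Lemma strip_escapes (C : set H) : compact C ->
  exists2 T0 : R, 0 < T0 & forall t k, T0 <= t -> K k -> ~ C (a t * k)%g.
Proof.
move=> cC; have [cK _ _ KV] := K_sub.
pose C' := (fun z : H * H => (z.1 * z.2)%g) @` (C `*` K).
have cC' : compact C'.
  apply: continuous_compact; last exact: compact_setX.
  by apply: continuous_subspaceT; exact: mulg_continuous.
have : at_infinity H (~` C') by exists C'.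
move=> /a_infty [M [_ MC']].
exists (`|M| + 1); first by rewrite ltr_wpDl.
move=> t k Mt Kk Catk; apply: (MC' t).
  by apply: lt_le_trans Mt; rewrite (le_lt_trans (ler_norm M))// ltrDl.
exists ((a t * k)%g, (k^-1)%g); first by split=> //=; exact: KV.
by rewrite /= -mulgA mulgV mulg1.
Qed.

End strips.

(** * Mixing and the mean ergodic theorem *)

(** The Markov operator of the random walk with step distribution [nu]. *)
Definition transfer (R : realType) (X : ptopologicalType)
    (H : topologicalGroupType) (act : H -> X -> X)
    (nu : probability (borel H) R) (f : X -> R) : X -> R :=
  fun y => \int[nu]_h f (act h y).

Section invariance.
Context (R : realType) (X : ptopologicalType) (H : topologicalGroupType).
Context (act : H -> X -> X) (act_cont : continuous_action act).
Context (m : probability (borel X) R).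

Lemma act_measurable h : measurable_fun setT (act h : borel X -> borel X).
Proof. by apply: continuous_borel_measurable; exact: act_continuous. Qed.

Lemma expect_invariant h (f : X -> R) : invariant_measure act m ->
  bmf (f : borel X -> R) -> \int[m]_y f (act h y) = \int[m]_y f y.
Proof.
move=> m_inv bf.
have [Q [Qm Qf]] := pushforward_probability m (act_measurable h).
rewrite -(Qf f bf); apply: EFin_inj.
rewrite -EFin_expectation// -EFin_expectation//.
by apply: integral_eq_set_fun => A mA; rewrite Qm; exact: m_inv.
Qed.

Lemma at_infinity_filter (T : topologicalType) : Filter (at_infinity T).
Proof.
apply: filter_from_filter; first by exists set0; exact: compact0.
move=> A B cA cB; exists (A `|` B); first exact: compactU.
by rewrite setCU.
Qed.

(** Mixing is assumed for sets; approximate [f] uniformly by the average of the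
indicators of its superlevel sets and expand the product. *)
Lemma mixing_function (f : X -> R) : mixing act m ->
  measurable_fun setT (f : borel X -> R) -> (forall y, 0 <= f y <= 1) ->
  forall e : R, 0 < e -> exists2 C : set H, compact C & forall h, ~ C h ->
    `|\int[m]_y (f (act h y) * f y) - (\int[m]_y f y) ^+ 2| <= e.
Proof.
move=> m_mix mf f01 e e0.
have FF := at_infinity_filter H.
have bf : bmf (f : borel X -> R).
  by split=> //; exists 1 => y; have /andP[? ?] := f01 y; rewrite ger0_norm.
have [n n0 ne] : exists2 n : nat, (0 < n)%N & n%:R^-1 <= e / 5.
  have e50 : 0 < e / 5 by rewrite divr_gt0.
  exists (Num.truncn (e / 5)^-1).+1 => //; rewrite invf_ple ?posrE//.
  exact/ltW/truncnS_gt.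
have n0' : 0 < n%:R :> R by rewrite ltr0n.
pose A k : set (borel X) := [set y | (k.+1)%:R / n%:R <= f y].
have mA k : measurable (A k).
  have -> : A k = f @^-1` `[(k.+1)%:R / n%:R, +oo[.
    by apply/seteqP; split=> y; rewrite /= in_itv/= andbT.
  by rewrite -[X in measurable X]setTI; apply: mf => //; exact: measurable_itv.
pose s (y : X) : R := n%:R^-1 * \sum_(k < n) \1_(A k) (y : borel X).
have bA k : bmf (\1_(A k) : borel X -> R) by exact: bmf_indic.
have bs : bmf (s : borel X -> R).
  by apply: bmfZ; apply: (@bmf_sum _ _ R 'I_n _ (fun k => \1_(A k))).
have fs y : `|f y - s y| <= n%:R^-1.
  apply: (@layer_approx R X f n (fun k y => \1_(A k) (y : borel X))) => //.
  - by move=> k z; rewrite indicE; case: (_ \in _); rewrite /= lexx ler01.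
  - by move=> k z kf; rewrite indicE mem_set.
  - move=> k z kf; rewrite indicE memNset// /A /=; apply/negP; rewrite -ltNge.
    by apply: le_lt_trans kf _; rewrite ltr_pM2r ?invr_gt0// ltr_nat.
have s01 y : 0 <= s y <= 1.
  rewrite /s mulr_ge0 ?invr_ge0 ?sumr_ge0//=.
  rewrite mulrC ler_pdivrMr// mul1r.
  rewrite -[leRHS](_ : \sum_(k < n) 1 = _); last by rewrite sumr_const card_ord.
  by apply: ler_sum => k _; rewrite indicE; case: (_ \in _).
have bcomp g h : bmf (g : borel X -> R) -> bmf ((fun y => g (act h y)) : borel X -> R).
  move=> bg; apply: (bmf_comp (phi := (act h : borel X -> borel X)) _ bg).
  exact: act_measurable.
have cs : \int[m]_y (s (act h y) * s y) @[h --> at_infinity H]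
    --> (\int[m]_y s y) ^+ 2.
  have Es : \int[m]_y s y = n%:R^-1 * \sum_(k < n) fine (m (A k)).
    rewrite expectZ; last by apply: (@bmf_sum _ _ R 'I_n _ (fun k => \1_(A k))).
    rewrite (@expect_sum _ _ R m 'I_n _ (fun k => \1_(A k)))//.
    by congr (_ * _); apply: eq_bigr => k _; rewrite expect_indic.
  have Ess h : \int[m]_y (s (act h y) * s y) =
      n%:R^-1 * (n%:R^-1 * \sum_(k < n) \sum_(l < n)
        fine (m (A k `&` act h @^-1` A l))).
    have -> : (fun y => s (act h y) * s y) = (fun y => n%:R^-1 * (n%:R^-1 *
        \sum_(k < n) \sum_(l < n) \1_(A k `&` act h @^-1` A l) (y : borel X))).
      apply/funext => y; rewrite /s mulrACA -mulrA; congr (_ * (_ * _)).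
      rewrite mulrC big_distrlr /=; apply: eq_bigr => k _; apply: eq_bigr => l _.
      by rewrite indicI.
    have mI k l : measurable (A k `&` act h @^-1` A l).
      apply: measurableI => //; rewrite -[X in measurable X]setTI.
      exact: act_measurable.
    have bI k l : bmf (\1_(A k `&` act h @^-1` A l) : borel X -> R).
      exact: bmf_indic.
    have bI2 (k : 'I_n) : bmf (fun y : borel X => \sum_(l < n)
        (\1_(A k `&` act h @^-1` A l) y : R)).
      by apply: (@bmf_sum _ _ R 'I_n _ (fun l => \1_(A k `&` act h @^-1` A l))).
    have bI3 : bmf (fun y : borel X => \sum_(k < n) \sum_(l < n)
        (\1_(A k `&` act h @^-1` A l) y : R)).
      exact: bmf_sum.
    rewrite expectZ; last exact: bmfZ.
    rewrite expectZ//; congr (_ * (_ * _)); rewrite expect_sum//.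
    apply: eq_bigr => k _.
    rewrite (@expect_sum _ _ R m 'I_n _ (fun l => \1_(A k `&` act h @^-1` A l)))//.
    by apply: eq_bigr => l _; rewrite expect_indic.
  under eq_fun do rewrite Ess.
  have -> : (\int[m]_y s y) ^+ 2 = n%:R^-1 * (n%:R^-1 * \sum_(k < n) \sum_(l < n)
      (fine (m (A k)) * fine (m (A l)))).
    by rewrite Es expr2 mulrACA -mulrA big_distrlr.
  apply: cvgM; first exact: cvg_cst.
  apply: cvgM; first exact: cvg_cst.
  apply: cvg_big => [|k _]; first exact: add_continuous.
  apply: cvg_big => [|l _]; first exact: add_continuous.
  have := m_mix _ _ (mA k) (mA l).
  have -> : (m (A k) * m (A l) = (fine (m (A k)) * fine (m (A l)))%:E)%E.
    by rewrite EFinM !fineK//; exact: fin_num_measure.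
  by move=> /fine_cvg.
have e50 : 0 < e / 5 by rewrite divr_gt0.
have /cvgrPdist_le /(_ _ e50) [C cC Ch] := cs.
exists C => // h nC; have := Ch h nC.
have d1 : `|\int[m]_y (f (act h y) * f y) - \int[m]_y (s (act h y) * s y)|
    <= n%:R^-1 + n%:R^-1.
  apply: expect_close; [by apply: bmfM => //; exact: bcomp|
    by apply: bmfM => //; exact: bcomp|move=> y].
  have -> : f (act h y) * f y - s (act h y) * s y =
    (f (act h y) - s (act h y)) * f y + s (act h y) * (f y - s y) by ring.
  apply: (le_trans (ler_normD _ _)).
  rewrite (normrM (f (act h y) - s (act h y))) (normrM (s (act h y)) (f y - s y)).
  have /andP[? ?] := f01 y; have /andP[? ?] := s01 (act h y).
  apply: lerD.
    by rewrite -[leRHS]mulr1; apply: ler_pM => //; rewrite ger0_norm.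
  by rewrite -[leRHS]mul1r; apply: ler_pM => //; rewrite ger0_norm.
have d2 := expect_close m bf bs fs.
have /andP[f0 f1] := expect_ge0_le1 m bf f01.
have /andP[s0 s1] := expect_ge0_le1 m bs s01.
have d3 : `|(\int[m]_y f y) ^+ 2 - (\int[m]_y s y) ^+ 2| <= n%:R^-1 + n%:R^-1.
  rewrite subr_sqr normrM.
  have -> : n%:R^-1 + n%:R^-1 = n%:R^-1 * 2 :> R by ring.
  by apply: ler_pM => //; rewrite ger0_norm; lra.
move: d1 d3; rewrite !ler_distl => /andP[? ?] /andP[? ?] /andP[? ?].
lra.
Qed.

End invariance.

Section mean_ergodic.
Context (R : realType) (X : ptopologicalType) (H : topologicalGroupType).
Hypotheses (X_lcsc : lcsc X) (H_lcsc : lcsc H).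
Context (act : H -> X -> X) (act_cont : continuous_action act).
Context (a : R -> H) (K : set H).
Hypothesis a_sub : one_parameter_subgroup a.
Hypothesis K_sub : compact_subgroup K.
Hypothesis K_comm : forall t k, K k -> (a t * k)%g = (k * a t)%g.
Context (nu : probability (borel H) R) (c d : R).
Hypothesis nu_supp : nu (strip a K c d) = 1%E.

Local Notation P := (transfer act nu).

Let actC (y : X) : continuous (act^~ y).
Proof.
apply: (@continuous_act _ _ _ act_cont _ id (cst y)); first by move=> h.
exact: cst_continuous.
Qed.

Lemma orbit_bmf (f : X -> R) y : bcont f -> bmf ((fun h => f (act h y)) : borel H -> R).
Proof. by move=> bf; apply: bcont_bmf; apply: bcont_comp. Qed.

Lemma strip_measurable s t : measurable (strip a K s t : set (borel H)).
Proof.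
apply: closed_borel_measurable; apply: compact_closed; first by case: H_lcsc.
exact: strip_compact.
Qed.

(** Continuity does not require a countable base at [y]: [nu] lives on a compact
set of elements [h], over which [f (h y)] is continuous in [y] uniformly. *)
Lemma transfer_bcont f : bcont f -> bcont (P f).
Proof.
move=> bf; have [cf [M fM]] := bf; split; last first.
  exists M => y; apply: expect_abs_le; [exact: orbit_bmf|by move=> h].
move=> y; apply/cvgrPdist_le => e e0.
have cF : continuous (fun z : H * X => f (act z.1 z.2)).
  have [_ _ ca] := act_cont => z.
  by apply: (@continuous_comp _ _ _ (fun z : H * X => act z.1 z.2) f);
    [exact: ca|exact: cf].
have cK : compact (strip a K c d) by exact: strip_compact.
have : \forall z \near y, strip a K c d `<=`
    (fun h => `|f (act h y) - f (act h z)| <= e).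
  apply: ((@compact_near_coveringP _ _).1 cK) => h _.
  have e20 : 0 < e / 2 by rewrite divr_gt0.
  have /cvgrPdist_le /(_ _ e20) [[A B] /= [Ah By] AB] := cF (h, y).
  exists (A, B) => // -[h' y'] /= [Ah' By'].
  have /= h1 := AB (h', y') (conj Ah' By').
  have /= h2 := AB (h', y) (conj Ah' (nbhs_singleton By)).
  rewrite (_ : _ - _ = (f (act h y) - f (act h' y')) - (f (act h y) - f (act h' y))).
    by apply: (le_trans (ler_normB _ _)); rewrite (splitr e) lerD.
  by ring.
apply: filterS => y' /= yy'.
rewrite /transfer -expectB; [|exact: orbit_bmf|exact: orbit_bmf].
apply: (expect_abs_le_on (strip_measurable c d) nu_supp (ltW e0)).
  by apply: bmfB; exact: orbit_bmf.
by move=> h /yy'.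
Qed.

Lemma transfer01 f : bcont f -> (forall y, 0 <= f y <= 1) ->
  forall y, 0 <= P f y <= 1.
Proof.
move=> bf f01 y; apply: expect_ge0_le1; first exact: orbit_bmf.
by move=> h.
Qed.

Lemma iter_transfer_bcont n f : bcont f -> bcont (iter n P f).
Proof. by move=> bf; elim: n => [//|n ih] /=; exact: transfer_bcont. Qed.

Lemma iter_transfer01 n f : bcont f -> (forall y, 0 <= f y <= 1) ->
  forall y, 0 <= iter n P f y <= 1.
Proof.
move=> bf f01; elim: n => [//|n ih] /= y.
by apply: transfer01 => //; exact: iter_transfer_bcont.
Qed.

Context (m : probability (borel X) R) (m_inv : invariant_measure act m).

Let act_bmf h (f : X -> R) : bmf (f : borel X -> R) ->
  bmf ((fun y => f (act h y)) : borel X -> R).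
Proof.
move=> bf; apply: (bmf_comp (phi := (act h : borel X -> borel X)) _ bf).
exact: act_measurable.
Qed.

Let joint_bmf (g : X -> R) : bcont g ->
  bmf ((fun z => g (act z.1 z.2)) : (borel H * borel X)%type -> R).
Proof.
have [_ _ sH] := H_lcsc; have [_ _ sX] := X_lcsc; have [_ _ ca] := act_cont.
move=> bg; apply: bcont_prod_bmf => //.
by apply: (@bcont_comp _ _ _ (fun z : H * X => act z.1 z.2)).
Qed.

Lemma transfer_corr (g psi : X -> R) : bcont g -> bmf (psi : borel X -> R) ->
  \int[m]_y (P g y * psi y) = \int[nu]_h \int[m]_y (g (act h y) * psi y).
Proof.
move=> bg bpsi.
have bF : bmf ((fun z => g (act z.1 z.2) * psi z.2) :
    (borel H * borel X)%type -> R).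
  apply: bmfM; first exact: joint_bmf.
  by apply: (bmf_comp (phi := (@snd (borel H) (borel X)))) => //;
    exact: measurable_snd.
rewrite (expect_fubini nu m bF); apply: eq_Rintegral => y _ /=.
under [RHS]eq_Rintegral do rewrite mulrC.
rewrite expectZ; last exact: orbit_bmf.
by rewrite mulrC.
Qed.

(** [P^n f] is an average of the functions [f (h y)] with [h] a product of [n]
elements of the support.  The induction peels off one factor at a time, moving it
to [psi] by invariance of [m]; this avoids convolution powers of [nu]. *)
Lemma iter_transfer_corr n (f psi : X -> R) (v e : R) : 0 <= e ->
  bcont f -> bmf (psi : borel X -> R) ->
  (forall h, strip a K (n%:R * c) (n%:R * d) h ->
    `|\int[m]_y (f (act h y) * psi y) - v| <= e) ->
  `|\int[m]_y (iter n P f y * psi y) - v| <= e.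
Proof.
move=> e0 bf; elim: n psi => [|n ih] psi bpsi hS.
  have [_ K1 _ _] := K_sub.
  have := hS 1%g; rewrite !mul0r => /(_ (strip0 a_sub K1)).
  by under eq_Rintegral do rewrite (act1 act_cont).
have bg := iter_transfer_bcont n bf.
rewrite /= transfer_corr//.
have bG : bmf ((fun h => \int[m]_y (iter n P f (act h y) * psi y)) : borel H -> R).
  apply: (@bmf_marginal R _ _ (borel H) (borel X) m
    (fun z => iter n P f (act z.1 z.2) * psi z.2)).
  apply: bmfM; first exact: joint_bmf.
  by apply: (bmf_comp (phi := (@snd (borel H) (borel X)))) => //;
    exact: measurable_snd.
rewrite -(expect_cst nu v) -expectB//; last exact: bmf_cst.
apply: (expect_abs_le_on (strip_measurable c d) nu_supp e0).
  by apply: bmfB => //; exact: bmf_cst.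
move=> h hcd.
have move_h (g : X -> R) : bmf (g : borel X -> R) ->
    \int[m]_y (g (act h y) * psi y) = \int[m]_y (g y * psi (act h^-1%g y)).
  move=> bg'; rewrite -[RHS](expect_invariant act_cont h m_inv); last first.
    by apply: bmfM => //; exact: act_bmf.
  apply: eq_Rintegral => y _.
  by rewrite -(actM act_cont) mulVg (act1 act_cont).
rewrite move_h; last exact: bcont_bmf.
apply: ih; first exact: act_bmf.
move=> h' hn; have : strip a K (n.+1%:R * c) (n.+1%:R * d) (h' * h)%g.
  by rewrite -natr1 !mulrDl !mul1r; apply: strip_mul.
move=> /hS; rewrite (_ : \int[m]_y _ = \int[m]_y (f (act h' y) * psi (act h^-1%g y)))//.
under eq_Rintegral do rewrite (actM act_cont).
by rewrite (move_h (fun y => f (act h' y)))//; apply: act_bmf; exact: bcont_bmf.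
Qed.

Hypothesis m_mix : mixing act m.
Hypothesis a_infty : a t @[t --> +oo] --> at_infinity H.
Hypotheses (c_gt0 : 0 < c) (c_le_d : c <= d).

Lemma expect_iter_transfer n f : bcont f ->
  \int[m]_y iter n P f y = \int[m]_y f y.
Proof.
move=> bf; apply/eqP; rewrite -subr_eq0 -normr_le0.
have -> : \int[m]_y iter n P f y = \int[m]_y (iter n P f y * cst 1 y).
  by apply: eq_Rintegral => y _; rewrite mulr1.
apply: iter_transfer_corr => //; first exact: bmf_cst.
move=> h _; under eq_Rintegral do rewrite mulr1.
rewrite (expect_invariant act_cont h m_inv (bcont_bmf bf)).
by rewrite subrr normr0.
Qed.

(** Two products [h], [h'] of [i] and [j] elements of the support differ by
[h' * h^-1], whose flow component is at least [j * c - i * d]; when this is large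
[h' * h^-1] is outside the compact set beyond which mixing is effective. *)
Lemma iter_transfer_mixing f (e : R) : bcont f -> (forall y, 0 <= f y <= 1) ->
  0 < e -> exists2 T0 : R, 0 < T0 & forall i j : nat,
    T0 <= j%:R * c - i%:R * d ->
    `|\int[m]_y (iter i P f y * iter j P f y) - (\int[m]_y f y) ^+ 2| <= e.
Proof.
move=> bf f01 e0.
have mf : measurable_fun setT (f : borel X -> R) by case: (bcont_bmf bf).
have [C cC Ch] := mixing_function act_cont m_mix mf f01 e0.
have [T0 T00 CT0] := strip_escapes K_sub a_infty cC.
exists T0 => // i j Tij.
apply: iter_transfer_corr => //; [exact: ltW| |].
  by apply: bcont_bmf; exact: iter_transfer_bcont.
move=> h hi; under eq_Rintegral do rewrite mulrC.
apply: iter_transfer_corr => //; [exact: ltW| |].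
  by apply: act_bmf; exact: bcont_bmf.
move=> h' hj.
have : strip a K (j%:R * c - i%:R * d) (j%:R * d - i%:R * c) (h' * h^-1)%g.
  by apply: strip_mul => //; exact: strip_inv.
move=> /stripP[t [k [/andP[tij _] Kk hh]]].
have nC : ~ C (h' * h^-1)%g.
  by rewrite hh; apply: CT0 => //; exact: le_trans tij.
have := Ch _ nC; rewrite -(expect_invariant act_cont h m_inv); last first.
  by apply: bmfM; [apply: act_bmf|]; exact: bcont_bmf.
by under eq_Rintegral do rewrite -(actM act_cont) mulgVK.
Qed.

(** The functions [P^n f] with [n] in a lacunary sequence are almost uncorrelated,
so their average has small variance.  Lacunarity is needed because [P^i f] and
[P^j f] are only known to decorrelate when [j * c - i * d] is large. *)
Lemma mean_ergodic f (e : R) : bcont f -> (forall y, 0 <= f y <= 1) ->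
  0 < e -> exists (M : nat) (n_ : nat -> nat), (0 < M)%N /\
    \int[m]_y `|M%:R^-1 * \sum_(j < M) iter (n_ j) P f y - \int[m]_y f y| <= e.
Proof.
move=> bf f01 e0; set v := \int[m]_y f y.
have e20 : 0 < e ^+ 2 / 2 by rewrite divr_gt0// exprn_gt0.
have [T0 T00 T0P] := iter_transfer_mixing bf f01 e20.
(* With n_j = D^(j+1) and i < j, the quantity n_j * c - n_i * d is at least
   n_i * (D * c - d), hence at least T0. *)
have [D Dbig] : exists D : nat, d + T0 <= D%:R * c.
  exists (Num.truncn ((d + T0) / c)).+1.
  by rewrite -ler_pdivrMr//; exact/ltW/truncnS_gt.
have D1 : 1 <= D%:R :> R.
  rewrite ler1n lt0n; apply/negP => /eqP D0; move: Dbig; rewrite D0 mul0r => Db.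
  have := c_gt0; have := c_le_d; lra.
have [M M0 Me] : exists2 M : nat, (0 < M)%N & M%:R^-1 <= e ^+ 2 / 2.
  exists (Num.truncn (e ^+ 2 / 2)^-1).+1 => //; rewrite invf_ple ?posrE//.
  exact/ltW/truncnS_gt.
exists M, (fun j => (D ^ j.+1)%N); split=> //.
pose g j := iter (D ^ j.+1)%N P f.
have bg j : bmf (g j : borel X -> R).
  by apply: bcont_bmf; exact: iter_transfer_bcont.
have g01 j y : 0 <= g j y <= 1 by exact: iter_transfer01.
have gv j : \int[m]_y g j y = v by exact: expect_iter_transfer.
have far (i j : nat) : (i < j)%N -> `|\int[m]_y (g i y * g j y) - v ^+ 2| <= e ^+ 2 / 2.
  move=> ij; apply: T0P.
  have Dij : (D ^ i.+1)%:R * D%:R <= (D ^ j.+1)%:R :> R.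
    rewrite -natrM -expnSr ler_nat leq_pexp2l//.
    by rewrite -(ltr_nat R); apply: lt_le_trans D1.
  have Di : 1 <= (D ^ i.+1)%:R :> R.
    by rewrite natrX; apply: exprn_ege1.
  have h1 : T0 <= (D ^ i.+1)%:R * (D%:R * c - d).
    apply: (@le_trans _ _ (1 * (D%:R * c - d))); first by lra.
    by rewrite ler_wpM2r//; lra.
  have h2 : (D ^ i.+1)%:R * D%:R * c <= (D ^ j.+1)%:R * c by rewrite ler_pM2r.
  by lra.
have cov (i j : 'I_M) : \int[m]_y ((g i y - v) * (g j y - v)) <=
    e ^+ 2 / 2 + (i == j)%:R.
  have -> : \int[m]_y ((g i y - v) * (g j y - v)) =
      \int[m]_y (g i y * g j y) - v ^+ 2.
    have -> : (fun y => (g i y - v) * (g j y - v)) =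
        (fun y => (g i y * g j y - v * g i y) - (v * g j y - v ^+ 2)).
      by apply/funext => y; ring.
    have b1 : bmf ((fun y => g i y * g j y) : borel X -> R) by exact: bmfM.
    have b2 : bmf ((fun y => v * g i y) : borel X -> R) by exact: bmfZ.
    have b3 : bmf ((fun y => v * g j y) : borel X -> R) by exact: bmfZ.
    have b4 : bmf ((fun y => v ^+ 2) : borel X -> R) by exact: bmf_cst.
    rewrite (expectB m (bmfB b1 b2) (bmfB b3 b4)) (expectB m b1 b2) (expectB m b3 b4).
    rewrite (expectZ m v (bg i)) (expectZ m v (bg j)) expect_cst.
    by rewrite [\int[m]_x g i x](gv i) [\int[m]_x g j x](gv j); ring.
  have [ij|ji|eij] := ltngtP i j.
  - have := far _ _ ij; rewrite ler_distl => /andP[_ ?].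
    have -> : (i == j) = false by apply/eqP => eij; rewrite eij ltnn in ij.
    by rewrite addr0; lra.
  - have := far _ _ ji; rewrite ler_distl => /andP[_ ?].
    under eq_Rintegral do rewrite mulrC.
    have -> : (i == j) = false by apply/eqP => eij; rewrite eij ltnn in ji.
    by rewrite addr0; lra.
  - rewrite (_ : (i == j) = true) /=; last exact/eqP/val_inj.
    have : \int[m]_y (g i y * g j y) <= 1.
      rewrite -(expect_cst m 1); apply: expect_le; [exact: bmfM|exact: bmf_cst|move=> y].
      have /andP[? ?] := g01 i y; have /andP[? ?] := g01 j y.
      by rewrite -[leRHS]mulr1; apply: ler_pM.
    by have := sqr_ge0 v; lra.
pose G y := M%:R^-1 * \sum_(j < M) g j y - v.
have MR0 : 0 < M%:R :> R by rewrite ltr0n.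
have bS : bmf ((fun y => \sum_(j < M) g j y) : borel X -> R).
  by apply: (@bmf_sum _ (borel X) R 'I_M _ (fun j => g j)).
have bG : bmf (G : borel X -> R).
  by apply: bmfB; [exact: bmfZ|exact: bmf_cst].
have bG2 : bmf ((fun y => G y ^+ 2) : borel X -> R) by exact: (bmfM bG bG).
have GE y : G y ^+ 2 = (M%:R^-1 * M%:R^-1) *
    (\sum_(i < M) \sum_(j < M) (g i y - v) * (g j y - v)).
  have -> : G y = M%:R^-1 * \sum_(j < M) (g j y - v).
    rewrite sumrB sumr_const card_ord mulrBr -[v *+ M]mulr_natl mulKf//.
    by rewrite gt_eqF.
  by rewrite expr2 mulrACA big_distrlr.
have bgg (i j : 'I_M) : bmf ((fun y => (g i y - v) * (g j y - v)) : borel X -> R).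
  by apply: bmfM; apply: bmfB => //; exact: bmf_cst.
have varG : \int[m]_y G y ^+ 2 <= e ^+ 2.
  under eq_Rintegral do rewrite GE.
  rewrite expectZ; last first.
    by apply: bmf_sum => i; apply: bmf_sum => j.
  rewrite expect_sum; last by move=> i; apply: bmf_sum => j.
  apply: (@le_trans _ _ (M%:R^-1 * M%:R^-1 *
      \sum_(i < M) \sum_(j < M) (e ^+ 2 / 2 + (i == j)%:R))).
    apply: ler_wpM2l; first by rewrite mulr_ge0// invr_ge0 ltW.
    by apply: ler_sum => i _; rewrite expect_sum//; apply: ler_sum => j _.
  have -> : \sum_(i < M) \sum_(j < M) (e ^+ 2 / 2 + (i == j)%:R) =
      M%:R * (M%:R * (e ^+ 2 / 2) + 1) :> R.
    rewrite (eq_bigr (fun=> M%:R * (e ^+ 2 / 2) + 1)).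
      by rewrite sumr_const card_ord [RHS]mulr_natl.
    move=> i _; rewrite big_split /= sumr_const card_ord mulr_natl; congr (_ + _).
    rewrite (bigD1 i)//= eqxx big1 ?addr0// => j ji.
    by rewrite eq_sym (negbTE ji).
  have -> : M%:R^-1 * M%:R^-1 * (M%:R * (M%:R * (e ^+ 2 / 2) + 1)) =
      e ^+ 2 / 2 + M%:R^-1 by field; rewrite gt_eqF.
  by lra.
apply: (@le_trans _ _ (\int[m]_y (e / 2 + (2 * e)^-1 * G y ^+ 2))).
  apply: expect_le; first exact: bmf_norm.
    apply: bmfD; first exact: bmf_cst.
    exact: bmfZ.
  move=> y; rewrite -/(g _) -/(G y) -(real_normK (num_real (G y))).
  set t := `|G y|.
  (* AM-GM turns the variance bound into a bound of the first moment. *)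
  have -> : e / 2 + (2 * e)^-1 * t ^+ 2 = t + (2 * e)^-1 * (t - e) ^+ 2.
    by field; rewrite gt_eqF.
  by rewrite lerDl mulr_ge0 ?sqr_ge0// invr_ge0 mulr_ge0// ltW.
rewrite (expectD m (bmf_cst _ _) (bmfZ _ bG2)) (expectZ m _ bG2) expect_cst.
have e2 : (2 * e)^-1 * e ^+ 2 = e / 2 by field; rewrite gt_eqF.
have : (2 * e)^-1 * \int[m]_y G y ^+ 2 <= (2 * e)^-1 * e ^+ 2.
  by rewrite ler_wpM2l// invr_ge0 mulr_ge0// ltW.
rewrite e2 => h; apply: (@le_trans _ _ (e / 2 + e / 2)); last by lra.
exact: lerD.
Qed.

End mean_ergodic.

(** * Law of large numbers for the walk *)
Section resampling.
Context (R : realType) (H : topologicalGroupType).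
Context (nu : probability (borel H) R) (nuN : probability (seq_space H) R).
Hypothesis nuN_prod : is_infinite_product nu nuN.

Lemma coordinate_measurable i :
  measurable_fun setT ((fun b => b i) : seq_space H -> borel H).
Proof.
move=> _ A mA; apply: sub_sigma_algebra; exists i => //.
by exists A.
Qed.

Let cylinder n (A : nat -> set (borel H)) : set (seq_space H) :=
  [set b : nat -> borel H | forall i, (i < n)%N -> A i (b i)].

Let cylinder_measurable n A : (forall i, measurable (A i)) ->
  measurable (cylinder n A).
Proof.
move=> mA.
have -> : cylinder n A = \bigcap_(i in `I_n) ((fun b : seq_space H => b i) @^-1` A i).
  by apply/seteqP; split=> b bA i /=; exact: bA.
apply: bigcap_measurableType => i _.
by rewrite -[X in measurable X]setTI; exact: coordinate_measurable.
Qed.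

(** Cylinders form a generating pi-system. *)
Lemma seq_space_measure_unique (m1 m2 : probability (seq_space H) R) :
  (forall n A, (forall i, measurable (A i)) ->
    m1 [set b : nat -> borel H | forall i, (i < n)%N -> A i (b i)] =
    m2 [set b : nat -> borel H | forall i, (i < n)%N -> A i (b i)]) ->
  forall E, measurable E -> m1 E = m2 E.
Proof.
move=> m12.
pose G : set (set (seq_space H)) :=
  [set E | exists n A, (forall i, measurable (A i)) /\ E = cylinder n A].
have GT : G setT.
  exists 0%N, (fun=> setT); split=> //.
  by apply/seteqP; split=> // b _ i.
have Gm : G `<=` measurable by move=> _ [n [A [mA ->]]]; exact: cylinder_measurable.
have GI : setI_closed G.
  move=> _ _ [n1 [A1 [mA1 ->]]] [n2 [A2 [mA2 ->]]].
  exists (maxn n1 n2), (fun i => (if (i < n1)%N then A1 i else setT) `&`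
    (if (i < n2)%N then A2 i else setT)); split.
    by move=> i; apply: measurableI; case: ifP.
  apply/seteqP; split=> b.
    by move=> [b1 b2] i _; split; case: ifP => // lt_i; [exact: b1|exact: b2].
  move=> bI; split=> i lt_i.
    by have := bI i; rewrite leq_max lt_i => /(_ isT)[].
  by have := bI i; rewrite leq_max lt_i orbT => /(_ isT)[].
have sG : forall E : set (seq_space H), measurable E -> <<s G >> E.
  apply: smallest_sub; first exact: smallest_sigma_algebra.
  move=> _ [i _ [A mA <-]]; apply: sub_sigma_algebra.
  exists i.+1, (fun j => if j == i then A else setT); split.
    by move=> j; case: ifP.
  apply/seteqP; split=> b /=.
    by move=> [_ bA] j _; case: eqP => // ->.
  by move=> /(_ i (ltnSn i)); rewrite eqxx.
move=> E /sG sE.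
apply: (@g_sigma_algebra_measure_unique _ R (seq_space H) G Gm (fun=> setT)) => //.
- by rewrite bigcup_const//; exists 0%N.
- by move=> _ [n [A [mA ->]]]; exact: m12.
- move=> k; have : (m1 setT < +oo)%E by rewrite probability_setT ltry.
  exact.
Qed.

Definition resample (q : nat) (b : nat -> H) (h : H) : nat -> H :=
  fun i => if i == q then h else b i.

Let resample2 q : (seq_space H * borel H)%type -> seq_space H :=
  fun z => resample q z.1 z.2.

Let resample_measurable q : measurable_fun setT (resample2 q).
Proof.
apply: (@measurability _ _ (seq_space H * borel H)%type (seq_space H) setT
  (resample2 q) (@coordinate_sets H)) => //.
move=> _ [_ [i _ [A mA <-]] <-]; rewrite !setTI.
case: (eqVneq i q) => [iq|iq].
  have -> : resample2 q @^-1` ((fun b : nat -> borel H => b i) @^-1` A) =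
      (@snd (seq_space H) (borel H)) @^-1` A.
    by apply/seteqP; split=> z; rewrite /resample2 /resample /= iq eqxx.
  by rewrite -[X in measurable X]setTI; exact: measurable_snd.
have -> : resample2 q @^-1` ((fun b : nat -> borel H => b i) @^-1` A) =
    (@fst (seq_space H) (borel H)) @^-1` ((fun b : seq_space H => b i) @^-1` A).
  by apply/seteqP; split=> z; rewrite /resample2 /resample /= (negbTE iq).
rewrite -[X in measurable X]setTI; apply: measurable_fst => //.
by rewrite -[X in measurable X]setTI; exact: coordinate_measurable.
Qed.

Let nuNE n A : (forall i, measurable (A i)) ->
  nuN (cylinder n A) = (\prod_(i < n) nu (A i))%E.
Proof. exact: nuN_prod. Qed.

(** Replacing the [q]-th step by an independent copy does not change the law of the
sequence, as both laws agree on cylinders.  This is the only consequence of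
independence that is used: it integrates out one coordinate. *)
Lemma expect_resample q (Phi : (nat -> H) -> R) :
  bmf (Phi : seq_space H -> R) ->
  bmf ((fun z => Phi (resample q z.1 z.2)) : (seq_space H * borel H)%type -> R) /\
  \int[nuN]_b Phi b = \int[nuN]_b \int[nu]_h Phi (resample q b h).
Proof.
move=> bPhi; have bF := bmf_comp (resample_measurable q) bPhi.
split=> //.
have [Q [Qm Qf]] := pushforward_probability
  ((nuN \x nu)%E : probability (seq_space H * borel H)%type R)
  (resample_measurable q).
have QE E : measurable E -> Q E = nuN E.
  apply: seq_space_measure_unique => n A mA; rewrite Qm.
  have -> : resample2 q @^-1` cylinder n A =
      cylinder n (fun i => if i == q then setT else A i) `*`
      (if (q < n)%N then A q else setT).
    apply/seteqP; split=> -[b h] /=.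
      rewrite /resample2 /resample /= => bA; split.
        by move=> i /bA; case: ifP.
      by case: ifP => // /bA; rewrite eqxx.
    move=> [bA hA] i lt_i; rewrite /resample2 /resample /=.
    case: eqP => [iq|/eqP iq]; first by move: hA; rewrite -iq lt_i.
    by have := bA i lt_i; rewrite (negbTE iq).
  have mA' i : measurable (if i == q then setT else A i) by case: ifP.
  have prodE : (nuN \x nu)%E (cylinder n (fun i => if i == q then setT else A i) `*`
      (if (q < n)%N then A q else setT)) =
      (nuN (cylinder n (fun i => if i == q then setT else A i)) *
      nu (if (q < n)%N then A q else setT))%E.
    apply: product_measure1E; first exact: cylinder_measurable.
    by case: ifP.
  apply: (etrans prodE); rewrite nuNE//.
  transitivity (\prod_(i < n) nu (A i))%E; last by symmetry; exact: nuNE.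
  have nuT : nu setT = 1%E by exact: probability_setT.
  case: ifP => [qn|/negbT qn].
    rewrite (bigD1 (Ordinal qn))//= eqxx [in RHS](bigD1 (Ordinal qn))//=.
    rewrite nuT mul1e muleC; congr (_ * _)%E; apply: eq_bigr => i iq.
    by rewrite (_ : (nat_of_ord i == q) = false)//; apply: contraNF iq.
  rewrite nuT mule1; apply: eq_bigr => i _.
  case: eqP => // iq; move: qn; rewrite -iq ltn_ord //.
have -> : \int[nuN]_b Phi b = \int[Q]_b Phi b.
  apply: EFin_inj; rewrite -!EFin_expectation//.
  by apply: integral_eq_set_fun => E mE; rewrite QE.
rewrite Qf//; apply: EFin_inj.
apply: (etrans _ (esym (expect_fubini_section nuN nu bF))).
apply: (etrans (esym (EFin_expectation _ bF))).
symmetry; apply: (@integral12_prod_meas1 _ _ _ _ R nuN nu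
  (EFin \o (fun z => Phi (resample q z.1 z.2)))).
exact: (bmf_integrable ((nuN \x nu)%E : probability (seq_space H * borel H)%type R) bF).
Qed.

End resampling.

Section subsequence.
Context (R : realType).

Lemma square_between (N : nat) : exists n, (n ^ 2 <= N < n.+1 ^ 2)%N.
Proof.
elim: N => [|N [n /andP[n1 n2]]]; first by exists 0%N.
case: (ltnP N.+1 (n.+1 ^ 2)) => [lt|ge].
  by exists n; rewrite lt (leq_trans n1).
by exists n.+1; rewrite ge /= (leq_trans (n := (n.+1 ^ 2).+1))// ltn_sqr.
Qed.

(** Between two consecutive squares [n ^ 2] and [(n + 1) ^ 2] there are at most
[2 n] further terms, negligible compared with [n ^ 2]. *)
Lemma mean_cvg_along_squares (D : nat -> R) : (forall p, `|D p| <= 1) ->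
  (n ^ 2)%:R^-1 * (\sum_(p < n ^ 2) D p) @[n --> \oo] --> 0 ->
  N%:R^-1 * (\sum_(p < N) D p) @[N --> \oo] --> 0.
Proof.
move=> D1 cD; apply/cvgrPdist_le => e e0.
have e20 : 0 < e / 2 by rewrite divr_gt0.
have /cvgrPdist_le /(_ _ e20) [M1 _ M1P] := cD.
pose M := maxn M1 (Num.truncn (4 / e)).+1.
exists (M ^ 2)%N => // N /= MN.
have [n /andP[nN Nn]] := square_between N.
have Mn : (M <= n)%N by rewrite -ltnS -ltn_sqr; exact: leq_ltn_trans Nn.
have := M1P n (leq_trans (leq_maxl _ _) Mn).
rewrite !sub0r !normrN => h1.
have n0 : (0 < n)%N by apply: leq_trans Mn; rewrite leq_max orbT.
have n0' : 0 < n%:R :> R by rewrite ltr0n.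
have N0 : (0 < N)%N by apply: leq_trans nN; rewrite expn_gt0 n0.
have N0' : 0 < N%:R :> R by rewrite ltr0n.
have n4 : 2 / n%:R <= e / 2.
  have : 4 / e <= n%:R.
    apply: ltW; apply: (lt_le_trans (truncnS_gt _)).
    by rewrite ler_nat; apply: leq_trans Mn; rewrite leq_maxr.
  rewrite ler_pdivrMr// => h; rewrite ler_pdivrMr//; lra.
have split_sum : \sum_(p < N) D p = \sum_(p < n ^ 2) D p + \sum_(n ^ 2 <= p < N) D p.
  by rewrite -!(big_mkord xpredT) -big_cat_nat.
have tail : `|\sum_(n ^ 2 <= p < N) D p| <= 2 * n%:R.
  apply: (le_trans (ler_norm_sum _ _ _)).
  apply: (@le_trans _ _ (\sum_(n ^ 2 <= p < N) 1)); first by apply: ler_sum => p _.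
  rewrite sumr_const_nat -natrM ler_nat.
  by move: Nn; rewrite !expnS !expn0; lia.
have nN' : (n ^ 2)%:R <= N%:R :> R by rewrite ler_nat.
have nn0 : 0 < (n ^ 2)%:R :> R by rewrite ltr0n expn_gt0 n0.
rewrite split_sum mulrDr (splitr e).
apply: (le_trans (ler_normD _ _)); apply: lerD.
  apply: le_trans h1; rewrite !normrM ler_wpM2r//.
  by rewrite !ger0_norm ?invr_ge0 ?ler0n// lef_pV2.
apply: le_trans n4; rewrite normrM ger0_norm ?invr_ge0 ?ler0n//.
apply: (@le_trans _ _ ((n ^ 2)%:R^-1 * (2 * n%:R))).
  by apply: ler_pM => //; rewrite ?invr_ge0 ?ler0n// lef_pV2.
rewrite natrX le_eqVlt; apply/orP; left; apply/eqP.
by field; rewrite gt_eqF.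
Qed.

Lemma nneseries_lty_cvg0 (Z : nat -> R) : (forall n, 0 <= Z n) ->
  (\sum_(0 <= n <oo) (Z n)%:E < +oo)%E -> Z @ \oo --> 0.
Proof.
move=> Z0 Zfin.
have Z0' k : (0 <= (Z k)%:E)%E by rewrite lee_fin.
have tl : (fun N => (\sum_(N <= k <oo) (Z k)%:E)%E) @ \oo --> 0%E.
  by apply: (@nneseries_tail_cvg _ (fun k => (Z k)%:E)).
have cvgE : (EFin \o Z) @ \oo --> 0%E.
  apply: (@squeeze_cvge _ _ _ _ (fun=> 0%E) _ (fun N => (\sum_(N <= k <oo) (Z k)%:E)%E)).
  - apply: nearW => n; rewrite /= Z0' /=.
    rewrite (@nneseries_split _ _ n 1)//; rewrite addn1 big_nat1 leeDl//.
    exact: nneseries_ge0.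
  - exact: cvg_cst.
  - exact: tl.
exact: (fine_cvg cvgE).
Qed.

End subsequence.

Section martingale_law.
Context (R : realType) (X : ptopologicalType) (H : topologicalGroupType).
Hypotheses (X_lcsc : lcsc X) (H_lcsc : lcsc H).
Context (act : H -> X -> X) (act_cont : continuous_action act).
Context (nu : probability (borel H) R) (nuN : probability (seq_space H) R).
Hypothesis nuN_prod : is_infinite_product nu nuN.
Context (x : X).

Lemma walk_measurable p :
  measurable_fun setT ((fun b => walk b p) : seq_space H -> borel H).
Proof.
have [_ _ sH] := H_lcsc.
elim: p => [|p ih] /=; first exact: measurable_cst.
have mmul : measurable_fun setT
    ((fun z => (z.1 * z.2)%g) : (borel H * borel H)%type -> borel H).
  apply: (@measurability _ _ (borel H * borel H)%type (borel H) setT _ (@open H)) => //.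
  move=> _ [U oU <-]; rewrite setTI; apply: open_prod_borel_measurable => //.
  by apply: open_comp => // z _; exact: mulg_continuous.
have mpair : measurable_fun setT
    ((fun b => (b p, walk b p)) : seq_space H -> (borel H * borel H)%type).
  by apply: measurable_fun_pair => //; exact: coordinate_measurable.
exact: (measurableT_comp mmul mpair).
Qed.

Let pos (b : nat -> H) p : X := act (walk b p) x.

Lemma position_bmf (g : X -> R) p : bcont g ->
  bmf ((fun b => g (act (walk b p) x)) : seq_space H -> R).
Proof.
move=> bg; apply: (@bmf_comp _ _ (seq_space H) (borel H) R
  (fun b => walk b p) (fun h => g (act h x)) (walk_measurable p)).
exact: (orbit_bmf act_cont).
Qed.

Lemma walk_resample q (b : nat -> H) h p : (p <= q)%N -> walk (resample q b h) p = walk b p.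
Proof.
elim: p => [//|p ih] pq /=.
rewrite ih ?(ltnW pq)// /resample (_ : (p == q) = false)//.
by apply/eqP => pq'; rewrite pq' ltnn in pq.
Qed.

Context (f : X -> R).
Hypotheses (bf : bcont f) (f01 : forall y, 0 <= f y <= 1).
Hypotheses (bPf : bcont (transfer act nu f)).
Hypotheses (Pf01 : forall y, 0 <= transfer act nu f y <= 1).

Let D p (b : nat -> H) : R := f (pos b p.+1) - transfer act nu f (pos b p).

Let D_bmf p : bmf (D p : seq_space H -> R).
Proof. by apply: bmfB; exact: position_bmf. Qed.

Let D_le1 p b : `|D p b| <= 1.
Proof.
have /andP[? ?] := f01 (pos b p.+1); have /andP[? ?] := Pf01 (pos b p).
by rewrite /D ler_norml; apply/andP; split; lra.
Qed.

Let D_resample p q b h : (p < q)%N -> D p (resample q b h) = D p b.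
Proof. by move=> pq; rewrite /D /pos !walk_resample// ltnW. Qed.

(** Resampling the [q]-th step leaves [D p] unchanged and averages [D q] to [0]. *)
Let D_orthogonal p q : (p < q)%N -> \int[nuN]_b (D p b * D q b) = 0.
Proof.
move=> pq.
have bDD : bmf ((fun b => D p b * D q b) : seq_space H -> R) by exact: bmfM.
have [_ ->] := expect_resample nuN_prod q bDD.
transitivity (\int[nuN]_b (0 : R)); last exact: expect_cst.
apply: eq_Rintegral => b _.
have -> : (fun h => D p (resample q b h) * D q (resample q b h)) =
    (fun h => D p b * (f (act h (pos b q)) - transfer act nu f (pos b q))).
  apply/funext => h; rewrite D_resample//; congr (_ * _).
  rewrite /D /pos /= !walk_resample//.
  by rewrite {1}/resample eqxx (actM act_cont).
have b1 : bmf ((fun h => f (act h (pos b q))) : borel H -> R).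
  exact: (orbit_bmf act_cont).
have b2 := bmf_cst (borel H) (transfer act nu f (pos b q)).
rewrite (expectZ nu _ (bmfB b1 b2)) (expectB nu b1 b2) expect_cst.
by rewrite /transfer subrr mulr0.
Qed.

Let variance_le N : \int[nuN]_b ((\sum_(p < N) D p b) * (\sum_(p < N) D p b)) <= N%:R.
Proof.
have bDD (i j : 'I_N) : bmf ((fun b => D i b * D j b) : seq_space H -> R).
  exact: bmfM.
have -> : (fun b => (\sum_(p < N) D p b) * (\sum_(p < N) D p b)) =
    (fun b => \sum_(i < N) \sum_(j < N) D i b * D j b).
  by apply/funext => b; rewrite big_distrlr.
rewrite (@expect_sum _ (seq_space H) R nuN 'I_N _
  (fun i b => \sum_(j < N) D i b * D j b)); last first.
  by move=> i; apply: (@bmf_sum _ (seq_space H) R 'I_N _ (fun j b => D i b * D j b)).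
rewrite -[leRHS](_ : \sum_(i < N) 1 = _); last by rewrite sumr_const card_ord.
apply: ler_sum => i _.
rewrite (@expect_sum _ (seq_space H) R nuN 'I_N _ (fun j b => D i b * D j b))//.
rewrite (bigD1 i)//= big1 ?addr0.
  rewrite -(expect_cst nuN 1); apply: expect_le => //; first exact: bmf_cst.
  move=> b; apply: (le_trans (ler_norm _)); rewrite normrM -[leRHS]mulr1.
  by apply: ler_pM.
move=> j ji; have [ij|ji'|ij] := ltngtP i j.
- exact: D_orthogonal.
- by under eq_Rintegral do rewrite mulrC; exact: D_orthogonal.
- by move/eqP: ji; case; apply/val_inj.
Qed.

(** By orthogonality the second moment of the mean of [N] terms is at most [1 / N],
which is summable along [N = n ^ 2]; [mean_cvg_along_squares] fills the gaps. *)
Lemma walk_transfer_law :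
  {ae nuN, forall b : nat -> H,
    N%:R^-1 * (\sum_(p < N) (f (act (walk b p.+1) x) -
      transfer act nu f (act (walk b p) x))) @[N --> \oo] --> 0}.
Proof.
pose Z n (b : nat -> H) : R :=
  ((n.+1 ^ 2)%:R^-1 * \sum_(p < n.+1 ^ 2) D p b) ^+ 2.
have bS N : bmf ((fun b => \sum_(p < N) D p b) : seq_space H -> R).
  by apply: (@bmf_sum _ (seq_space H) R 'I_N _ (fun j b => D j b)).
have bZ n : bmf (Z n : seq_space H -> R).
  exact: (bmfM (bmfZ _ (bS _)) (bmfZ _ (bS _))).
have Z0 n b : 0 <= Z n b by exact: sqr_ge0.
have EZ n : \int[nuN]_b Z n b <= (n.+1 ^ 2)%:R^-1.
  have N0 : 0 < (n.+1 ^ 2)%:R :> R by rewrite ltr0n expn_gt0.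
  have -> : (fun b => Z n b) = (fun b => ((n.+1 ^ 2)%:R^-1 * (n.+1 ^ 2)%:R^-1) *
      ((\sum_(p < n.+1 ^ 2) D p b) * (\sum_(p < n.+1 ^ 2) D p b))).
    by apply/funext => b; rewrite /Z expr2 mulrACA.
  rewrite (expectZ nuN _ (bmfM (bS _) (bS _))).
  apply: (@le_trans _ _ ((n.+1 ^ 2)%:R^-1 * (n.+1 ^ 2)%:R^-1 * (n.+1 ^ 2)%:R)).
    by apply: ler_wpM2l; [rewrite mulr_ge0// invr_ge0 ltW|exact: variance_le].
  by rewrite mulfVK// gt_eqF.
have partial n : \sum_(0 <= k < n) (k.+1 ^ 2)%:R^-1 <= 2 :> R.
  case: n => [|n]; first by rewrite big_geq.
  suff : \sum_(0 <= k < n.+1) (k.+1 ^ 2)%:R^-1 <= 2 - n.+1%:R^-1 :> R.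
    move=> h; apply: (le_trans h); rewrite gerBl invr_ge0 ler0n//.
  elim: n => [|n ih]; first by rewrite big_nat1 exp1n invr1; lra.
  rewrite big_nat_recr//=; apply: (le_trans (lerD ih (lexx _))).
  have n0 : 0 < n.+1%:R :> R by rewrite ltr0n.
  have n1 : 0 < n.+2%:R :> R by rewrite ltr0n.
  have n2 : n.+2%:R = n.+1%:R + 1 :> R by rewrite -natr1.
  have h2 : n.+1%:R^-1 - n.+2%:R^-1 = (n.+1%:R * n.+2%:R)^-1 :> R.
    rewrite n2; move: (n.+1%:R) n0 => u u0.
    by field; apply/andP; split; apply: lt0r_neq0 => //; lra.
  have h3 : (n.+2 ^ 2)%:R^-1 <= (n.+1%:R * n.+2%:R)^-1 :> R.
    rewrite lef_pV2 ?posrE ?mulr_gt0 ?ltr0n ?expn_gt0//.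
    by rewrite -natrM ler_nat; lia.
  move: h2 h3; move: (n.+1%:R^-1) (n.+2%:R^-1) ((n.+1%:R * n.+2%:R)^-1)
    ((n.+2 ^ 2)%:R^-1) => u v w z h2 h3.
  by lra.
have fin : (\int[nuN]_b (\sum_(0 <= n <oo) (Z n b)%:E) < +oo)%E.
  have -> : (\int[nuN]_b (\sum_(0 <= n <oo) (Z n b)%:E) =
      \sum_(0 <= n <oo) (\int[nuN]_b Z n b)%:E)%E.
    rewrite integral_nneseries//.
    - by apply: eq_eseriesr => n _; exact: EFin_expectation.
    - by move=> n; apply/measurable_EFinP; case: (bZ n).
    - by move=> n b _; rewrite lee_fin.
  apply: (@le_lt_trans _ _ 2%:E); last exact: ltry.
  apply: lime_le.
    by apply: is_cvg_nneseries => n _ _; rewrite lee_fin; exact: expect_ge0.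
  apply: nearW => n; rewrite sumEFin lee_fin; apply: le_trans (partial n).
  by apply: ler_sum => k _.
have intZ : nuN.-integrable setT
    (fun b : seq_space H => (\sum_(0 <= n <oo) (Z n b)%:E)%E).
  apply/integrableP; split.
    apply: ge0_emeasurable_sum => // [n b _ _|n _]; first by rewrite lee_fin.
    by apply/measurable_EFinP; case: (bZ n).
  rewrite (eq_integral (fun b : seq_space H => (\sum_(0 <= n <oo) (Z n b)%:E)%E))//.
  move=> b _; rewrite gee0_abs//; apply: nneseries_ge0 => n _ _.
  by rewrite lee_fin.
have := integrable_ae measurableT intZ.
apply: filterS => b /(_ I) fb.
apply: (@mean_cvg_along_squares R (fun p => D p b)) => [p|]; first exact: D_le1.
have cZ : Z ^~ b @ \oo --> 0.
  apply: nneseries_lty_cvg0 => //.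
  by move: fb; rewrite fin_numElt => /andP[].
pose Y n := (n ^ 2)%:R^-1 * \sum_(p < n ^ 2) D p b.
rewrite -(cvg_shiftS Y); apply/cvgrPdist_le => e e0.
have e20 : 0 < e ^+ 2 by rewrite exprn_gt0.
have /cvgrPdist_le /(_ _ e20) := cZ.
apply: filterS => n; rewrite !sub0r !normrN.
rewrite ger0_norm// /Z -/(Y n.+1) => h.
by rewrite -(@ler_sqr _ `|_|) ?nnegrE ?(ltW e0)// real_normK// num_real.
Qed.

End martingale_law.

(** * The averages as probabilities *)
Section interval_integrals.
Context (R : realType).
Implicit Types (g : R -> R).
Local Notation mu := (@lebesgue_measure R).

Definition itv_integral g (s t : R) : R := \int[mu]_(u in `[s, t]) g u.

Lemma bmf_itv_integrable g s t : bmf g -> mu.-integrable `[s, t] (EFin \o g).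
Proof.
move=> [mg [M gM]]; apply: measurable_bounded_integrable => //.
- have : (mu `[s, t] < +oo)%E.
    by rewrite lebesgue_measure_itv /=; case: ifP => _; rewrite ?ltry// -EFinD ltry.
  exact.
- exact: measurable_funS mg.
- by exists M; split; [exact: num_real|move=> N MN u _ /=; apply: le_trans (ltW MN)].
Qed.

Lemma fine_itv_measure s t : s <= t -> fine (mu `[s, t]) = t - s.
Proof.
rewrite lebesgue_measure_itv /= lte_fin le_eqVlt => /predU1P[->|->] //=.
by rewrite ltxx subrr.
Qed.

Lemma itv_integral_cst s t r : s <= t -> itv_integral (cst r) s t = r * (t - s).
Proof. by move=> st; rewrite /itv_integral Rintegral_cst// fine_itv_measure. Qed.

Lemma itv_integralD g h s t : bmf g -> bmf h ->
  itv_integral (fun u => g u + h u) s t = itv_integral g s t + itv_integral h s t.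
Proof. by move=> bg bh; apply: RintegralD => //; exact: bmf_itv_integrable. Qed.

Lemma itv_integral_le g h s t : bmf g -> bmf h ->
  (forall u, s <= u <= t -> g u <= h u) ->
  itv_integral g s t <= itv_integral h s t.
Proof.
by move=> bg bh gh; apply: le_Rintegral => //; exact: bmf_itv_integrable.
Qed.

Lemma itv_integral_ge0 g s t : (forall u, 0 <= g u) -> 0 <= itv_integral g s t.
Proof. by move=> g0; apply: Rintegral_ge0. Qed.

Lemma itv_integral_split g s r t : bmf g -> s <= r <= t ->
  itv_integral g s t = itv_integral g s r + itv_integral g r t.
Proof.
move=> bg /andP[sr rt]; apply/eqP; rewrite addrC -subr_eq; apply/eqP.
rewrite /itv_integral -(@Rintegral_itv_obnd_cbnd _ r).
  apply: Rintegral_itvB; rewrite ?bnd_simp//.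
  exact: bmf_itv_integrable.
apply: (integrableS _ _ _ (@bmf_itv_integrable g r t bg)) => //.
exact: subset_itv_oc_cc.
Qed.

Lemma itv_integral_shift g s t r : continuous g -> bmf g -> s <= t ->
  itv_integral (fun u => g (u + r)) s t = itv_integral g (s + r) (t + r).
Proof.
move=> cg bg st.
have dF : derive1 (fun u : R => u + r) = cst 1.
  apply/funext => u; rewrite derive1E deriveD//.
  by rewrite derive_id derive_cst addr0.
rewrite /itv_integral /Rintegral; congr fine.
rewrite (@integration_by_substitution_increasing _ (fun u => u + r) g)//.
- by apply: eq_integral => u _; rewrite /= fctE dF mulr1.
- by move=> u v _ _; rewrite ltrD2r.
- by rewrite dF => u _; exact: cst_continuous.
- by rewrite dF; apply/cvg_ex; exists 1; exact: cvg_cst.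
- by rewrite dF; apply/cvg_ex; exists 1; exact: cvg_cst.
- have cF : continuous (fun u : R => u + r).
    by move=> u; apply: continuousD => //; exact: cst_continuous.
  split.
  + by move=> u _; apply: derivableD.
  + by apply: cvg_at_right_filter; exact: cF.
  + by apply: cvg_at_left_filter; exact: cF.
- by apply: continuous_subspaceT.
Qed.

Lemma expect_uniform g (T : R) (T0 : 0 < T) : bmf g ->
  \int[uniform_prob T0]_u g u = T^-1 * itv_integral g 0 T.
Proof.
move=> bg; have [mg [M gM]] := bg.
have bgM : bmf (fun u => g u + M) by apply: bmfD => //; exact: bmf_cst.
have mgM : measurable_fun setT (fun u => (g u + M)%:E).
  by apply/measurable_EFinP; case: bgM.
have g0 u : (0 <= (g u + M)%:E)%E.
  by rewrite lee_fin; have := gM u; rewrite ler_norml => /andP[? _]; lra.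
have E1 : \int[uniform_prob T0]_u (g u + M) = T^-1 * itv_integral (fun u => g u + M) 0 T.
  rewrite /Rintegral (integral_uniform T0 mgM g0) subr0 fineM//.
  apply: integrable_fin_num => //.
  exact: (bmf_itv_integrable 0 T bgM).
move: E1; rewrite (expectD (uniform_prob T0) bg (bmf_cst _ M)) expect_cst.
rewrite (itv_integralD _ _ bg (bmf_cst _ M)) itv_integral_cst ?ltW//.
rewrite subr0 mulrDr mulrA (mulrC T^-1 M) mulfVK ?gt_eqF//.
by move/addIr.
Qed.

End interval_integrals.

Section averages.
Context (R : realType) (X : ptopologicalType) (H : topologicalGroupType).
Context (act : H -> X -> X) (act_cont : continuous_action act).

Lemma walk_average_probability (b : nat -> H) (x : X) (N : nat) : (0 < N)%N ->
  exists P : probability (borel X) R,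
    (forall A, walk_average R act b x N A = P A) /\
    forall f : X -> R, bmf (f : borel X -> R) ->
      \int[P]_y f y = N%:R^-1 * \sum_(p < N) f (act (walk b p.+1) x).
Proof.
move=> N0; have N0' : 0 < N%:R :> R by rewrite ltr0n.
have Ni0 : (0 <= N%:R^-1 :> R) by rewrite invr_ge0 ltW.
pose k : {nonneg R} := NngNum Ni0.
pose dp (p : nat) : {measure set (borel X) -> \bar R} :=
  \d_(act (walk b p.+1) x : borel X).
pose M : {measure set (borel X) -> \bar R} := mscale k (msum dp N).
have ME A : M A = (N%:R^-1%:E * \sum_(p < N) dp p A)%E by [].
have [P PM] : exists P : probability (borel X) R, forall A, P A = M A.
  apply: measure_to_probability; rewrite ME.
  rewrite (eq_bigr (fun=> 1%E)); last by move=> p _; exact: diracT.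
  by rewrite sumEFin sumr_const card_ord -EFinM mulVf// gt_eqF.
exists P; split=> [A|f bf].
  rewrite PM ME /walk_average; congr (_ * _)%E.
  by rewrite big_add1 big_mkord.
have pos (g : X -> R) : bmf (g : borel X -> R) -> (forall y, 0 <= g y) ->
    \int[P]_y g y = N%:R^-1 * \sum_(p < N) g (act (walk b p.+1) x).
  move=> [mg _] g0; rewrite /Rintegral.
  have mg' : measurable_fun setT (fun y : borel X => (g y)%:E) by exact/measurable_EFinP.
  have -> : (\int[P]_y (g y)%:E = \int[M]_y (g y)%:E)%E.
    by apply: integral_eq_set_fun => A _; exact: PM.
  have -> : (\int[M]_y (g y)%:E = N%:R^-1%:E * \int[msum dp N]_y (g y)%:E)%E.
    by apply: ge0_integral_mscale => // y _; rewrite lee_fin.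
  have -> : (\int[msum dp N]_y (g y)%:E = \sum_(p < N) \int[dp p]_y (g y)%:E)%E.
    by apply: ge0_integral_measure_sum => // y _; rewrite lee_fin.
  rewrite (eq_bigr (fun p : 'I_N => (g (act (walk b p.+1) x))%:E)).
    by rewrite sumEFin -EFinM.
  by move=> p _; rewrite integral_dirac// diracT mul1e.
have [mf [B fB]] := bf.
have bfB : bmf ((fun y => f y + B) : borel X -> R).
  by apply: bmfD => //; exact: bmf_cst.
have h0 y : 0 <= f y + B.
  by have := fB y; rewrite ler_norml => /andP[? _]; lra.
have := pos _ bfB h0; rewrite (expectD P bf (bmf_cst _ B)) expect_cst big_split /= sumr_const card_ord mulrDr -[B *+ N]mulr_natl.
by rewrite mulKf ?gt_eqF// => /addIr.
Qed.

Lemma continuous_real_borel_measurable (phi : R -> X) : continuous phi ->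
  measurable_fun setT (phi : R -> borel X).
Proof.
move=> cphi; apply: (@measurability _ _ _ (borel X) setT _ (@open X)) => //.
move=> _ [U oU <-]; rewrite setTI; apply: open_measurable.
by apply: open_comp => // u _; exact: cphi.
Qed.

Lemma flow_average_probability (a : R -> H) (x : X) (T : R) :
  continuous a -> 0 < T ->
  exists P : probability (borel X) R,
    (forall A, measurable A -> flow_average act a x T A = P A) /\
    forall f : X -> R, bmf (f : borel X -> R) ->
      \int[P]_y f y = T^-1 * itv_integral (fun t => f (act (a t) x)) 0 T.
Proof.
move=> ca T0.
have cphi : continuous (fun t => act (a t) x).
  by apply: (continuous_act act_cont ca); exact: cst_continuous.
have mphi := continuous_real_borel_measurable cphi.
have [P [Pm Pf]] := pushforward_probability (uniform_prob T0) mphi.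
exists P.
have Pf' (f : X -> R) : bmf (f : borel X -> R) ->
    \int[P]_y f y = T^-1 * itv_integral (fun t => f (act (a t) x)) 0 T.
  move=> bf; rewrite Pf//.
  apply: (@expect_uniform R (fun t => f (act (a t) x))).
  exact: (bmf_comp mphi bf).
split=> // A mA.
have bA : bmf (\1_A : borel X -> R) by exact: bmf_indic.
have := Pf' _ bA; rewrite expect_indic// => PA.
rewrite -[RHS]fineK; last exact: fin_num_measure.
rewrite PA EFinM /flow_average; congr (_ * _)%E.
rewrite /itv_integral /Rintegral fineK.
  by apply: eq_integral => t _; rewrite diracE indicE.
apply: integrable_fin_num => //.
apply: (@bmf_itv_integrable R (fun t => \1_A (act (a t) x : borel X))).
exact: (bmf_comp mphi bA).
Qed.

End averages.

(** * Equicontinuity and convergence of dominated averages *)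
Section equicontinuity.
Context (R : realType) (X : ptopologicalType) (H : topologicalGroupType).
Hypotheses (X_lcsc : lcsc X) (H_lcsc : lcsc H).
Context (act : H -> X -> X) (act_cont : continuous_action act).
Context (a : R -> H) (K : set H).
Hypothesis a_sub : one_parameter_subgroup a.
Hypothesis K_sub : compact_subgroup K.
Hypothesis K_comm : forall t k, K k -> (a t * k)%g = (k * a t)%g.

(** The translations that move [f] by at most [e], together with all their
conjugates by [K].  Conjugates must be included because moving [u] across a step
[a t * k] of the walk replaces it by [k * u * k^-1]; with them, the modulus is
inherited by [P f] without loss for [u] commuting with the flow. *)
Definition conj_modulus (f : X -> R) (e : R) : set H :=
  [set u | forall k z, K k -> `|f (act (k * u * k^-1)%g z) - f z| <= e].

(** On the support [Q] of [f] this is uniform continuity over the compact set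
[K] x [Q].  Where [f z] vanishes but [f] does not vanish at the translate of [z],
apply the same bound at the translate with [u^-1]. *)
Lemma conj_modulus_nbhs f e : Cc f -> 0 < e -> nbhs 1%g (conj_modulus f e).
Proof.
move=> [cf kf] e0; have [cK _ _ _] := K_sub.
set Q := closure [set y | f y != 0] in kf.
have cQK : compact (K `*` Q) by exact: compact_setX.
pose W : set H := [set u | forall k z, K k -> Q z ->
  `|f (act (k * u * k^-1)%g z) - f z| <= e].
have W1 : nbhs 1%g W.
  have : \forall u \near (1%g : H), K `*` Q `<=` (fun kz : H * X =>
      `|f (act (kz.1 * u * kz.1^-1)%g kz.2) - f kz.2| <= e).
    apply: ((@compact_near_coveringP _ _).1 cQK) => -[k z] _.
    pose F (q : (H * X) * H) : R :=
      f (act (q.1.1 * q.2 * q.1.1^-1)%g q.1.2) - f q.1.2.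
    have c1 : continuous (fun q : (H * X) * H => q.1.1).
      move=> q; apply: (@continuous_comp _ _ _ fst fst); exact: cvg_fst.
    have c2 : continuous (fun q : (H * X) * H => q.1.2).
      move=> q; apply: (@continuous_comp _ _ _ fst snd).
        exact: cvg_fst.
      exact: cvg_snd.
    have c3 : continuous (fun q : (H * X) * H => q.2).
      by move=> q; exact: cvg_snd.
    have cF : continuous F.
      move=> q; apply: (@continuousB _ _ _
        (fun q : (H * X) * H => f (act (q.1.1 * q.2 * q.1.1^-1)%g q.1.2))
        (fun q : (H * X) * H => f q.1.2)); last first.
        by apply: (@continuous_comp _ _ _ (fun q : (H * X) * H => q.1.2) f);
          [exact: c2|exact: cf].
      apply: (@continuous_comp _ _ _
        (fun q : (H * X) * H => act (q.1.1 * q.2 * q.1.1^-1)%g q.1.2) f);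
        last exact: cf.
      apply: (continuous_act act_cont _ c2).
      apply: continuous_mulg; last exact: continuous_invg.
      exact: continuous_mulg.
    have F0 : F ((k, z), 1%g) = 0.
      by rewrite /F /= mulg1 mulgV (act1 act_cont) subrr.
    have /cvgrPdist_le /(_ _ e0) := cF ((k, z), 1%g).
    rewrite F0 => -[[A B] /= [Akz B1] AB].
    exists (A, B) => // -[kz u] /= [Akz' Bu].
    by have := AB (kz, u) (conj Akz' Bu); rewrite /= sub0r normrN.
  by apply: filterS => u uW k z Kk Qz; exact: (uW (k, z)).
have W1' : nbhs 1%g [set u : H | W (u^-1)%g].
  have ci : {for (1%g : H), continuous (fun u : H => (u^-1)%g)}.
    exact: invg_continuous.
  by apply: ci; rewrite /= invg1.
apply: filterS2 W1 W1' => u Wu Wu' k z Kk.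
have [Qz|nQz] := pselect (Q z); first exact: Wu.
have f0 y : ~ Q y -> f y = 0.
  by move=> nQ; apply/eqP/negPn/negP => fy; apply: nQ; exact: subset_closure.
have [Qz'|nQz'] := pselect (Q (act (k * u * k^-1)%g z)); last first.
  by rewrite !f0// subrr normr0 ltW.
have := Wu' k _ Kk Qz'; rewrite -(actM act_cont).
have -> : (k * u^-1 * k^-1 * (k * u * k^-1) = 1)%g.
  by rewrite !mulgA mulgVK -(mulgA k) mulVg mulg1 mulgV.
by rewrite (act1 act_cont) distrC.
Qed.

Context (nu : probability (borel H) R) (c d : R).
Hypothesis nu_supp : nu (strip a K c d) = 1%E.

Local Notation P := (transfer act nu).

Lemma conj_modulus_transfer f e u : bcont f -> 0 <= e ->
  (forall t, (a t * u)%g = (u * a t)%g) ->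
  conj_modulus f e u -> conj_modulus (P f) e u.
Proof.
move=> bf e0 au fu k z Kk; have [_ _ KM KV] := K_sub.
rewrite /transfer -expectB; [|exact: (orbit_bmf act_cont)|exact: (orbit_bmf act_cont)].
apply: (expect_abs_le_on (strip_measurable H_lcsc a_sub K_sub c d) nu_supp e0).
  by apply: bmfB; exact: (orbit_bmf act_cont).
move=> h /stripP[t [k' [_ Kk' ->]]].
rewrite -(actM act_cont).
have -> : (a t * k' * (k * u * k^-1) =
    (k' * k) * u * (k' * k)^-1 * (a t * k'))%g.
  have -> : ((k' * k)^-1 = k^-1 * k'^-1)%g.
    by apply: (mulIg (k' * k)%g); rewrite mulVg -mulgA (mulgA (k'^-1)%g) mulVg mul1g mulVg.
  have cw : (a t * (k * u * k^-1) = k * u * k^-1 * a t)%g.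
    rewrite !mulgA (K_comm t Kk) -(mulgA k) au mulgA -(mulgA _ (a t)).
    by rewrite (K_comm t (KV _ Kk)) mulgA.
  by rewrite (K_comm t Kk') -mulgA cw !mulgA mulgVK.
rewrite (actM act_cont); apply: fu; exact: KM.
Qed.

Lemma conj_modulus_iter f e u n : bcont f -> 0 <= e ->
  (forall t, (a t * u)%g = (u * a t)%g) ->
  conj_modulus f e u -> conj_modulus (iter n P f) e u.
Proof.
move=> bf e0 au fu; elim: n => [//|n ih] /=.
apply: conj_modulus_transfer => //.
exact: (iter_transfer_bcont H_lcsc act_cont a_sub K_sub nu_supp).
Qed.

(** The order of the quantifiers matters: [A] is absolute and [C] depends on the
neighbourhood [G] but not on the function [h]. *)
Definition orbit_dominated (J : Type) (F : set_system J)
    (mu : J -> probability (borel X) R) (m : probability (borel X) R) : Prop :=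
  exists2 A : R, 0 <= A & forall G : set H, nbhs 1%g G ->
  exists2 C : R, 0 <= C & forall (h : X -> R) (e : R),
    bcont h -> (forall y, 0 <= h y <= 1) -> 0 <= e ->
    (forall u, G u -> (forall t, (a t * u)%g = (u * a t)%g) ->
      forall y, `|h (act u y) - h y| <= e) ->
    forall eta : R, 0 < eta -> \forall i \near F,
      \int[mu i]_y h y <= A * e + C * \int[m]_y h y + eta.

Context (m : probability (borel X) R).
Hypotheses (m_inv : invariant_measure act m) (m_mix : mixing act m).
Hypothesis a_infty : a t @[t --> +oo] --> at_infinity H.
Hypotheses (c_gt0 : 0 < c) (c_le_d : c <= d).

(** Choose [e1] so that [A * e1] is small, then [G] as the modulus of [f] at [e1],
which fixes [C], and only then the average [g] of iterates of [P] with
[C * m(|g - m(f)|)] small. *)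
Lemma orbit_dominated_cvg (J : Type) (F : set_system J) (FF : Filter F)
    (mu : J -> probability (borel X) R) (f : X -> R) :
  orbit_dominated F mu m -> Cc f -> (forall y, 0 <= f y <= 1) ->
  (forall n, \int[mu i]_y iter n P f y - \int[mu i]_y f y @[i --> F] --> 0) ->
  \int[mu i]_y f y @[i --> F] --> \int[m]_y f y.
Proof.
move=> [A A0 dom] ccf f01 Pn; have bf := Cc_bcont ccf.
apply/cvgrPdist_le => e e0.
set v := \int[m]_y f y.
have A1 : 0 < A + 1 by rewrite ltr_wpDl.
pose e1 := e / (4 * (A + 1)).
have e10 : 0 < e1 by rewrite divr_gt0// mulr_gt0.
have [C C0 domC] := dom _ (conj_modulus_nbhs ccf e10).
have C1 : 0 < C + 1 by rewrite ltr_wpDl.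
pose e2 := e / (4 * (C + 1)).
have e20 : 0 < e2 by rewrite divr_gt0// mulr_gt0.
have [M [n_ [M0 ME]]] := mean_ergodic X_lcsc H_lcsc act_cont a_sub K_sub K_comm
  nu_supp m_inv m_mix a_infty c_gt0 c_le_d bf f01 e20.
have M0' : 0 < M%:R :> R by rewrite ltr0n.
pose g y := M%:R^-1 * \sum_(j < M) iter (n_ j) P f y.
have bit n : bcont (iter n P f).
  exact: (iter_transfer_bcont H_lcsc act_cont a_sub K_sub nu_supp).
have it01 n y : 0 <= iter n P f y <= 1.
  exact: (iter_transfer01 H_lcsc act_cont a_sub K_sub nu_supp).
have bS : bcont (fun y => \sum_(j < M) iter (n_ j) P f y).
  by apply: (@bcont_sum _ X 'I_M _ (fun j => iter (n_ j) P f)).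
have cg : continuous g.
  move=> y; apply: (@continuousM _ _ (cst M%:R^-1)
    (fun y => \sum_(j < M) iter (n_ j) P f y)); first exact: cst_continuous.
  by case: bS => cS _; exact: cS.
have g01 y : 0 <= g y <= 1.
  have S0 : 0 <= \sum_(j < M) iter (n_ j) P f y.
    by apply: sumr_ge0 => j _; case/andP: (it01 (n_ j) y).
  have S1 : \sum_(j < M) iter (n_ j) P f y <= M%:R.
    rewrite -[leRHS](_ : \sum_(i < M) 1 = _); last by rewrite sumr_const card_ord.
    by apply: ler_sum => j _; case/andP: (it01 (n_ j) y).
  rewrite /g mulr_ge0 ?invr_ge0 ?ler0n//=.
  by rewrite mulrC ler_pdivrMr// mul1r.
have bg := bcont_bmf (bcont01 cg g01).
have /andP[v0 v1] := expect_ge0_le1 m (bcont_bmf bf) f01.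
rewrite -/v in v0 v1.
pose h y := `|g y - v|.
have ch : continuous h.
  move=> y; apply: (@continuous_comp _ _ _ (fun y => g y - v) Num.norm).
    by apply: continuousB; [exact: cg|exact: cst_continuous].
  exact: norm_continuous.
have h01 y : 0 <= h y <= 1.
  have /andP[? ?] := g01 y.
  by rewrite /h normr_ge0 /= ler_norml; apply/andP; split; lra.
have hG u : conj_modulus f e1 u -> (forall t, (a t * u)%g = (u * a t)%g) ->
    forall y, `|h (act u y) - h y| <= e1.
  move=> fu au y; rewrite /h; apply: (le_trans (ler_dist_dist _ _)).
  rewrite opprB addrA subrK /g -mulrBr -sumrB normrM.
  rewrite ger0_norm ?invr_ge0 ?ler0n// ler_pdivrMl//.
  apply: (le_trans (ler_norm_sum _ _ _)).
  rewrite -[leRHS](_ : \sum_(i < M) e1 = _); last first.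
    by rewrite sumr_const card_ord mulr_natl.
  apply: ler_sum => j _.
  have [_ K1 _ _] := K_sub.
  have := conj_modulus_iter (n_ j) bf (ltW e10) au fu y K1.
  by rewrite mul1g invg1 mulg1.
have e40 : 0 < e / 4 by rewrite divr_gt0.
have ev1 := domC h e1 (bcont01 ch h01) h01 (ltW e10) hG _ e40.
have cvg_g : \int[mu i]_y g y - \int[mu i]_y f y @[i --> F] --> 0.
  have gE i : \int[mu i]_y g y - \int[mu i]_y f y =
      M%:R^-1 * \sum_(j < M) (\int[mu i]_y iter (n_ j) P f y - \int[mu i]_y f y).
    rewrite (expectZ (mu i) _ (bcont_bmf bS)).
    rewrite (@expect_sum _ (borel X) R (mu i) 'I_M _ (fun j => iter (n_ j) P f));
      last by move=> j; exact: bcont_bmf.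
    rewrite sumrB sumr_const card_ord mulrBr -[\int[mu i]_y f y *+ M]mulr_natl mulKf//.
    by rewrite gt_eqF.
  have cS : M%:R^-1 * (\sum_(j < M) (\int[mu i]_y iter (n_ j) P f y -
      \int[mu i]_y f y)) @[i --> F] --> M%:R^-1 * \sum_(j < M) (0 : R).
    apply: cvgM; first exact: cvg_cst.
    by apply: cvg_big => [|j _]; [exact: add_continuous|exact: Pn].
  rewrite big1 ?mulr0// in cS.
  by under eq_fun do rewrite gE.
have /cvgrPdist_le /(_ _ e40) ev2 := cvg_g.
apply: filterS2 ev1 ev2 => i; rewrite sub0r normrN => ev1 ev2.
have gv : `|\int[mu i]_y g y - v| <= \int[mu i]_y h y.
  have := expect_abs (mu i) (bmfB bg (bmf_cst _ v)).
  by rewrite (expectB (mu i) bg (bmf_cst _ v)) expect_cst.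
have Ae : A * e1 <= e / 4.
  rewrite /e1 mulrA ler_pdivrMr ?mulr_gt0//.
  have -> : e / 4 * (4 * (A + 1)) = (A + 1) * e by field.
  by rewrite ler_pM2r// lerDl.
have Ce : C * \int[m]_y h y <= e / 4.
  apply: (@le_trans _ _ (C * e2)); first by apply: ler_wpM2l.
  rewrite /e2 mulrA ler_pdivrMr ?mulr_gt0//.
  have -> : e / 4 * (4 * (C + 1)) = (C + 1) * e by field.
  by rewrite ler_pM2r// lerDl.
have h1 : \int[mu i]_y h y <= e / 4 + e / 4 + e / 4.
  by apply: (le_trans ev1); rewrite !lerD.
have h2 : `|\int[mu i]_y g y - v| <= e / 4 + e / 4 + e / 4 by exact: le_trans h1.
rewrite distrC -[X in `|X - _|](subrK (\int[mu i]_y g y)) -addrA.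
apply: (le_trans (ler_normD _ _)); rewrite distrC.
apply: (le_trans (lerD ev2 h2)); lra.
Qed.

End equicontinuity.

(** * Comparison of the walk with the flow *)
Section comparison.
Context (R : realType) (X : ptopologicalType) (H : topologicalGroupType).
Context (act : H -> X -> X) (act_cont : continuous_action act).
Context (a : R -> H) (K : set H).
Hypothesis a_sub : one_parameter_subgroup a.
Hypothesis K_sub : compact_subgroup K.
Hypothesis K_comm : forall t k, K k -> (a t * k)%g = (k * a t)%g.
Context (c d : R).
Hypotheses (c_gt0 : 0 < c) (c_le_d : c <= d).

Lemma walk_decomposition (b : nat -> H) : (forall i, strip a K c d (b i)) ->
  exists (S : nat -> R) (kap : nat -> H), [/\ S 0%N = 0,
    forall p, c <= S p.+1 - S p <= d, forall p, K (kap p) &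
    forall p, walk b p = (a (S p) * kap p)%g].
Proof.
move=> bs; have [_ K1 KM _] := K_sub.
have ex i : exists tk : R * H, [/\ c <= tk.1 <= d, K tk.2 & b i = (a tk.1 * tk.2)%g].
  by have /stripP[t [k [tcd Kk ->]]] := bs i; exists (t, k).
have /choice[tk tkP] := ex.
pose S p := \sum_(i < p) (tk i).1.
pose kap := fix kap p := if p is q.+1 then ((tk q).2 * kap q)%g else 1%g.
exists S, kap; split=> [|p|p|p].
- by rewrite /S big_ord0.
- by rewrite /S big_ord_recr /= addrAC subrr add0r; have [] := tkP p.
- elim: p => [//|p ih] /=; apply: KM => //; by have [] := tkP p.
- elim: p => [|p ih] /=; first by rewrite /S big_ord0 (flow0 a_sub) mul1g.
  have [_ Kk ->] := tkP p.
  have -> : S p.+1 = (tk p).1 + S p by rewrite /S big_ord_recr /=; exact: addrC.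
  by rewrite ih (flowD a_sub) -!mulgA (mulgA (tk p).2) -(K_comm _ Kk) !mulgA.
Qed.

Lemma commutes_divg (g u v : H) :
  (g * u = u * g)%g -> (g * v = v * g)%g -> (g * (u * v^-1) = u * v^-1 * g)%g.
Proof.
move=> gu gv; rewrite mulgA gu -!mulgA; congr (_ * _)%g.
by apply: (mulIg v); rewrite mulgVK -(mulgA _ g) gv mulgA mulVg mul1g.
Qed.

(** The finitely many [k] reduce a compact set of displacements to translates by
elements of [G]. *)
Lemma strip_cover s t (G : set H) : nbhs 1%g G ->
  exists2 l : seq H, (forall k, k \in l -> strip a K s t k) &
    forall y, strip a K s t y -> exists2 k, k \in l & G (y * k^-1)%g.
Proof.
move=> G1; apply: (@compact_seq_cover _ H (strip a K s t)
  (fun k => [set y | G (y * k^-1)%g])); last exact: strip_compact.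
move=> k sk; exists k => //.
have cont : {for k, continuous (fun y : H => (y * k^-1)%g)}.
  by apply: (@continuous_mulg _ H id (cst (k^-1)%g)); [move=> z|exact: cst_continuous].
by apply: cont; rewrite /= mulgV.
Qed.

Lemma flow_modulus (G : set H) : nbhs 1%g G ->
  exists2 delta : R, 0 < delta <= c & forall s, 0 <= s <= delta -> G (a s).
Proof.
move=> G1; have [ca _] := a_sub.
have : nbhs (0 : R) (a @^-1` G) by apply: ca; rewrite (flow0 a_sub).
move=> /nbhs_ballP[r /= r0 rG].
exists (Num.min c (r / 2)); first by rewrite lt_min c_gt0 divr_gt0//= ge_min lexx.
move=> s /andP[s0 sr]; apply: rG; rewrite /ball /= sub0r normrN ger0_norm//.
apply: (le_lt_trans sr); rewrite gt_min; apply/orP; right.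
by rewrite ltr_pdivrMr// ltr_pMr// ltr1n.
Qed.

Context (x : X).

Definition walk_mean (b : nat -> H) N (f : X -> R) : R :=
  N%:R^-1 * \sum_(p < N) f (act (walk b p.+1) x).

Definition flow_mean (T : R) (f : X -> R) : R :=
  T^-1 * itv_integral (fun t => f (act (a t) x)) 0 T.

Let orbit_continuous : continuous (fun t => act (a t) x).
Proof.
have [ca _] := a_sub.
by apply: (continuous_act act_cont ca); exact: cst_continuous.
Qed.

Lemma flow_bmf (f : X -> R) : bcont f -> bmf (fun t => f (act (a t) x)).
Proof.
move=> bf; apply: (bmf_comp (U := borel X)); last exact: bcont_bmf.
exact: continuous_real_borel_measurable.
Qed.

Context (m : probability (borel X) R) (m_inv : invariant_measure act m).

Let translates (l : seq H) (h : X -> R) (y : X) : R := \sum_(k <- l) h (act k y).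

Let translates_bcont l (h : X -> R) : bcont h -> bcont (translates l h).
Proof.
move=> bh; apply: (@bcont_sum _ X H l (fun k y => h (act k y))) => k.
by apply: bcont_comp => //; exact: act_continuous.
Qed.

Let translates_ge l (h : X -> R) k y : (forall y, 0 <= h y) -> k \in l ->
  h (act k y) <= translates l h y.
Proof.
move=> h0 kl; rewrite /translates (big_rem k)//= lerDl.
by apply: sumr_ge0.
Qed.

Let expect_translates l (h : X -> R) : bcont h ->
  \int[m]_y translates l h y = (size l)%:R * \int[m]_y h y.
Proof.
move=> bh.
rewrite (@expect_sum _ (borel X) R m H l (fun k y => h (act k y))); last first.
  by move=> k; apply: bcont_bmf; apply: bcont_comp => //; exact: act_continuous.
rewrite (eq_bigr (fun=> \int[m]_y h y)); last first.
  by move=> k _; apply: expect_invariant => //; exact: bcont_bmf.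
by rewrite big_const_seq count_predT iter_addr_0 mulr_natl.
Qed.

Let step_le (S : nat -> R) : S 0%N = 0 -> (forall p, c <= S p.+1 - S p <= d) ->
  forall p, c * p%:R <= S p <= d * p%:R.
Proof.
move=> S0 Sp; elim=> [|p /andP[ih1 ih2]]; first by rewrite S0 !mulr0 lexx.
by have /andP[? ?] := Sp p; rewrite -natr1 !mulrDr !mulr1; apply/andP; split; lra.
Qed.

(** The position after [p] steps is [kap p] applied to the flow orbit at time
[S p].  Up to [2 * e], the value of [h] there is bounded by [Hs], a finite sum of
translates of [h], at any time of [[S p, S p + delta]].  As [delta <= c], these
time intervals do not overlap and lie in [[0, d * (N + 1)]]. *)
Lemma walk_dominated (b : nat -> H) : (forall i, strip a K c d (b i)) ->
  (forall h, bcont h -> flow_mean T h @[T --> +oo] --> \int[m]_y h y) ->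
  forall G : set H, nbhs 1%g G ->
  exists2 C : R, 0 <= C & forall (h : X -> R) (e : R),
    bcont h -> (forall y, 0 <= h y <= 1) -> 0 <= e ->
    (forall u, G u -> (forall t, (a t * u)%g = (u * a t)%g) ->
      forall y, `|h (act u y) - h y| <= e) ->
    forall eta : R, 0 < eta -> \forall N \near \oo,
      walk_mean b N h <= 2 * e + C * \int[m]_y h y + eta.
Proof.
move=> bs flow_cvg G G1.
have [S [kap [S0 Sp Kkap walkE]]] := walk_decomposition bs.
have [delta /andP[dl0 dlc] Gdl] := flow_modulus G1.
have [l lK lcov] := strip_cover 0 0 G1.
have d0 : 0 < d by exact: lt_le_trans c_le_d.
exists (2 * d / delta * (size l)%:R).
  by rewrite mulr_ge0// divr_ge0 ?mulr_ge0 ?ltW.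
move=> h e bh h01 e0 hG eta eta0.
have h0 y : 0 <= h y by case/andP: (h01 y).
pose Hs := translates l h.
have bHs : bcont Hs by exact: translates_bcont.
have Hs0 y : 0 <= Hs y by apply: sumr_ge0.
pose phi t := Hs (act (a t) x).
have bphi : bmf phi by exact: flow_bmf.
have phi0 t : 0 <= phi t by exact: Hs0.
have pointwise p u : S p <= u <= S p + delta ->
    h (act (walk b p) x) <= 2 * e + phi u.
  move=> /andP[Su uS].
  have [k kl Gk] := lcov _ (strip0 a_sub (Kkap p)).
  have kc : forall t, (a t * k)%g = (k * a t)%g := strip_comm a_sub K_comm (lK _ kl).
  have kapc : forall t, (a t * kap p)%g = (kap p * a t)%g :=
    strip_comm a_sub K_comm (strip0 a_sub (Kkap p)).
  have wc t : (a t * (kap p * k^-1) = kap p * k^-1 * a t)%g.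
    exact: commutes_divg.
  have e1 := hG _ Gk wc (act (k * a (S p))%g x).
  rewrite -(actM act_cont) in e1.
  have w1 : (kap p * k^-1 * (k * a (S p)) = walk b p)%g.
    by rewrite mulgA mulgVK walkE kapc.
  rewrite w1 in e1.
  have e2' : `|h (act k (act (a u) x)) - h (act (k * a (S p))%g x)| <= e.
    have : G (a (u - S p)) by apply: Gdl; apply/andP; split; lra.
    move=> /hG /(_ _ (act (k * a (S p))%g x)).
    rewrite -!(actM act_cont) mulgA kc -mulgA -(flowD a_sub) subrK; apply.
    by move=> t; rewrite -!(flowD a_sub) addrC.
  have := translates_ge (act (a u) x) h0 kl; rewrite -/(Hs _) -/(phi u) => le_phi.
  by move: e1 e2'; rewrite !ler_distl => /andP[? ?] /andP[? ?]; lra.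
have block p : delta * h (act (walk b p) x) <=
    2 * e * delta + itv_integral phi (S p) (S p + delta).
  have Sd : S p <= S p + delta by rewrite lerDl ltW.
  have := @itv_integral_le R (cst (h (act (walk b p) x))) (fun u => 2 * e + phi u)
    (S p) (S p + delta) (bmf_cst _ _) (bmfD (bmf_cst _ _) bphi) (pointwise p).
  rewrite (itv_integralD _ _ (bmf_cst _ _) bphi) !itv_integral_cst//.
  by rewrite addrC addKr mulrC.
have Sle := step_le S0 Sp.
have blocks N : \sum_(p < N) itv_integral phi (S p.+1) (S p.+1 + delta) <=
    itv_integral phi 0 (S N.+1).
  elim: N => [|N ih].
    by rewrite big_ord0; exact: itv_integral_ge0.
  have /andP[SN0 _] := Sle N.+1.
  have SN0' : 0 <= S N.+1 by apply: le_trans SN0; rewrite mulr_ge0// ltW.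
  have /andP[SN _] := Sp N.+1.
  rewrite big_ord_recr /=; apply: (le_trans (lerD ih (lexx _))).
  rewrite (@itv_integral_split R phi 0 (S N.+1) (S N.+2))//; last first.
    by apply/andP; split; lra.
  rewrite (@itv_integral_split R phi (S N.+1) (S N.+1 + delta) (S N.+2))//; last first.
    by apply/andP; split; lra.
  by rewrite lerD2l lerDl; exact: itv_integral_ge0.
pose eta' := eta * delta / (2 * d).
have eta'0 : 0 < eta' by rewrite divr_gt0 ?mulr_gt0.
have /cvgrPdist_le /(_ _ eta'0) [T0 [_ T0P]] := flow_cvg _ bHs.
(* N is large enough for the flow average over [0, d * (N + 1)]. *)
exists (Num.truncn (`|T0| / d)).+1 => // N /= NT.
have N0 : (0 < N)%N by apply: leq_trans NT.
have N0' : 0 < N%:R :> R by rewrite ltr0n.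
have N1' : 1 <= N%:R :> R by rewrite ler1n.
pose T := d * N.+1%:R.
have TT0 : T0 < T.
  apply: (le_lt_trans (ler_norm T0)).
  have : `|T0| / d < N%:R.
    by apply: (lt_le_trans (truncnS_gt _)); rewrite ler_nat.
  by rewrite ltr_pdivrMr// /T -natr1; lra.
have T0' : 0 < T by rewrite mulr_gt0.
have flowT := T0P _ TT0.
set E := \int[m]_y h y.
have E0 : 0 <= (size l)%:R * E + eta'.
  by rewrite addr_ge0 ?(ltW eta'0)// mulr_ge0// expect_ge0.
have intT : itv_integral phi 0 T <= T * ((size l)%:R * E + eta').
  move: flowT; rewrite ler_distl (expect_translates l bh) => /andP[hT _].
  rewrite -ler_pdivrMl//; move: hT; rewrite /flow_mean -/Hs -/phi -/E.
  by rewrite lerBlDr.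
have intS : itv_integral phi 0 (S N.+1) <= itv_integral phi 0 T.
  have /andP[SN0 SNd] := Sle N.+1.
  rewrite (@itv_integral_split R phi 0 (S N.+1) T)//; last first.
    by rewrite SNd (le_trans _ SN0)// mulr_ge0// ltW.
  by rewrite lerDl; exact: itv_integral_ge0.
have TN : T <= 2 * d * N%:R.
  have -> : 2 * d * N%:R = d * (N%:R + N%:R) by ring.
  by rewrite /T -natr1 ler_pM2l// lerD2l.
have total : delta * \sum_(p < N) h (act (walk b p.+1) x) <=
    N%:R * (2 * e * delta) + 2 * d * N%:R * ((size l)%:R * E + eta').
  rewrite mulr_sumr.
  apply: (@le_trans _ _ (\sum_(p < N) (2 * e * delta +
      itv_integral phi (S p.+1) (S p.+1 + delta)))).
    by apply: ler_sum => p _; exact: block.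
  rewrite big_split /= sumr_const card_ord -[_ *+ N]mulr_natl lerD2l.
  apply: (le_trans (blocks N)); apply: (le_trans intS); apply: (le_trans intT).
  by rewrite ler_wpM2r.
rewrite /walk_mean ler_pdivrMl// -(ler_pM2l dl0); apply: (le_trans total).
rewrite le_eqVlt; apply/orP; left; apply/eqP.
by rewrite /eta'; field; rewrite !gt_eqF.
Qed.

(** For [t] in [[S p, S p.+1]] the point [a t x] is obtained from the position after
[p + 1] steps by an element of the compact set [strip (- d) 0]; so its value
under [h] is at most [e] plus that of a finite sum [Hs] of translates of [h] at
that position.  Each step covers a time at most [d], and a time [T] is covered by
at most [2 * T / c] steps. *)
Lemma flow_dominated (b : nat -> H) : (forall i, strip a K c d (b i)) ->
  (forall h, bcont h -> walk_mean b N h @[N --> \oo] --> \int[m]_y h y) ->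
  forall G : set H, nbhs 1%g G ->
  exists2 C : R, 0 <= C & forall (h : X -> R) (e : R),
    bcont h -> (forall y, 0 <= h y <= 1) -> 0 <= e ->
    (forall u, G u -> (forall t, (a t * u)%g = (u * a t)%g) ->
      forall y, `|h (act u y) - h y| <= e) ->
    forall eta : R, 0 < eta -> \forall T \near +oo,
      flow_mean T h <= 2 * d / c * e + C * \int[m]_y h y + eta.
Proof.
move=> bs walk_cvg G G1.
have [S [kap [S0 Sp Kkap walkE]]] := walk_decomposition bs.
have [l lK lcov] := strip_cover (- d) 0 G1.
have d0 : 0 < d by exact: lt_le_trans c_le_d.
exists (2 * d / c * (size l)%:R).
  by rewrite mulr_ge0// divr_ge0 ?mulr_ge0 ?ltW.
move=> h e bh h01 e0 hG eta eta0.
have h0 y : 0 <= h y by case/andP: (h01 y).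
pose Hs := translates l h.
have bHs : bcont Hs by exact: translates_bcont.
have Hs0 y : 0 <= Hs y by apply: sumr_ge0.
pose psi t := h (act (a t) x).
have bpsi : bmf psi by exact: flow_bmf.
have psi0 t : 0 <= psi t by exact: h0.
have Sle := step_le S0 Sp.
have [_ _ KM KV] := K_sub.
have pointwise p t : S p <= t <= S p.+1 ->
    psi t <= e + Hs (act (walk b p.+1) x).
  move=> /andP[St tS]; have /andP[Sc Sd] := Sp p.
  pose y := (a (t - S p.+1) * (kap p.+1)^-1)%g.
  have ys : strip a K (- d) 0 y.
    apply: stripI; last exact: KV.
    by apply/andP; split; lra.
  have yE : act (a t) x = act y (act (walk b p.+1) x).
    rewrite -(actM act_cont) walkE /y (K_comm _ (Kkap p.+1)) !mulgA mulgVK.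
    by rewrite -(flowD a_sub) subrK.
  have [k kl Gk] := lcov _ ys.
  have kc := strip_comm a_sub K_comm (lK _ kl); have yc := strip_comm a_sub K_comm ys.
  have wc r : (a r * (y * k^-1) = y * k^-1 * a r)%g.
    exact: commutes_divg.
  have := hG _ Gk wc (act k (act (walk b p.+1) x)).
  rewrite -(actM act_cont (y * k^-1)%g k) mulgVK -yE ler_distl => /andP[_ h1].
  have := translates_ge (act (walk b p.+1) x) h0 kl.
  by rewrite -/(Hs _) /psi; lra.
have block p : itv_integral psi (S p) (S p.+1) <=
    d * (e + Hs (act (walk b p.+1) x)).
  have /andP[Sc Sd] := Sp p.
  have Spp : S p <= S p.+1 by have := c_gt0; lra.
  have := @itv_integral_le R psi (cst (e + Hs (act (walk b p.+1) x)))
    (S p) (S p.+1) bpsi (bmf_cst _ _) (pointwise p).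
  rewrite itv_integral_cst// => hb; apply: (le_trans hb).
  by rewrite mulrC ler_wpM2r// addr_ge0.
have blocks N : itv_integral psi 0 (S N) <=
    \sum_(p < N) (d * (e + Hs (act (walk b p.+1) x))).
  elim: N => [|N ih].
    by rewrite big_ord0 S0 /itv_integral set_itv1 Rintegral_set1.
  have /andP[SN0 _] := Sle N.
  have SN0' : 0 <= S N by apply: le_trans SN0; rewrite mulr_ge0// ltW.
  have /andP[SN _] := Sp N.
  rewrite (@itv_integral_split R psi 0 (S N) (S N.+1))//; last first.
    by have := c_gt0; move=> c0; apply/andP; split; lra.
  by rewrite big_ord_recr /=; apply: lerD.
set E := \int[m]_y h y.
pose eta' := eta * c / (2 * d).
have eta'0 : 0 < eta' by rewrite divr_gt0 ?mulr_gt0.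
have /cvgrPdist_le /(_ _ eta'0) [N0 _ N0P] := walk_cvg _ bHs.
exists (Num.max c (c * N0%:R)); split; first exact: num_real.
move=> T; rewrite gt_max => /andP[cT NT].
have T0 : 0 < T by exact: lt_trans cT.
pose N := (Num.truncn (T / c)).+1.
have TN : T / c < N%:R by exact: truncnS_gt.
have NTc : N%:R <= 2 * T / c.
  have h1 : (Num.truncn (T / c))%:R <= T / c.
    by rewrite truncn_le divr_ge0// ltW.
  have h2 : 1 <= T / c by rewrite ler_pdivlMr// mul1r ltW.
  by rewrite /N -natr1 -mulrA; lra.
have NN0 : (N0 <= N)%N.
  rewrite -(ler_nat R); apply: ltW; apply: lt_trans TN.
  by rewrite ltr_pdivlMr// mulrC.
have NR0 : 0 < N%:R :> R by rewrite ltr0n.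
have walkN : walk_mean b N Hs <= (size l)%:R * E + eta'.
  have := N0P N NN0; rewrite ler_distl (expect_translates l bh) => /andP[? _].
  by rewrite -lerBlDr.
have TS : T <= S N.
  have /andP[SN _] := Sle N; apply: le_trans SN.
  by move: TN; rewrite ltr_pdivrMr// mulrC => /ltW.
have intT : itv_integral psi 0 T <= itv_integral psi 0 (S N).
  rewrite (@itv_integral_split R psi 0 T (S N))//; last by rewrite ltW.
  by rewrite lerDl; exact: itv_integral_ge0.
have sumE : \sum_(p < N) (d * (e + Hs (act (walk b p.+1) x))) =
    d * N%:R * (e + walk_mean b N Hs).
  rewrite -mulr_sumr big_split /= sumr_const card_ord -[e *+ N]mulr_natl.
  rewrite -[RHS]mulrA; congr (_ * _).
  by rewrite /walk_mean [RHS]mulrDr mulVKf// gt_eqF.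
have wm0 : 0 <= walk_mean b N Hs.
  by rewrite mulr_ge0 ?invr_ge0 ?ler0n// sumr_ge0.
have total : itv_integral psi 0 T <=
    d * (2 * T / c) * (e + ((size l)%:R * E + eta')).
  apply: (le_trans intT); apply: (le_trans (blocks N)); rewrite sumE.
  apply: ler_pM; [by rewrite mulr_ge0// ltW|exact: addr_ge0| |].
    by rewrite ler_pM2l.
  by rewrite lerD2l.
rewrite /flow_mean ler_pdivrMl//; apply: (le_trans total).
rewrite le_eqVlt; apply/orP; left; apply/eqP.
by rewrite /eta'; field; rewrite !gt_eqF.
Qed.

End comparison.

(** * Asymptotic invariance under the transfer operator *)
Section asymptotic_invariance.
Context (R : realType) (X : ptopologicalType) (H : topologicalGroupType).
Hypotheses (X_lcsc : lcsc X) (H_lcsc : lcsc H).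
Context (act : H -> X -> X) (act_cont : continuous_action act).
Context (a : R -> H) (K : set H).
Hypothesis a_sub : one_parameter_subgroup a.
Hypothesis K_sub : compact_subgroup K.
Hypothesis K_comm : forall t k, K k -> (a t * k)%g = (k * a t)%g.
Context (x : X).

(** With this step distribution the mean ergodic theorem for the walk specialises to
the flow at integer times. *)
Definition time_one : probability (borel H) R := \d_(a 1 : borel H).

Lemma time_one_supp : time_one (strip a K 1 1) = 1%E.
Proof.
have [_ K1 _ _] := K_sub.
rewrite /time_one /= diracE mem_set//.
by rewrite -[a 1]mulg1; apply: stripI => //; rewrite lexx.
Qed.

Lemma transfer_time_one (g : X -> R) y : bcont g ->
  transfer act time_one g y = g (act (a 1) y).
Proof.
move=> bg; rewrite /transfer /Rintegral.
have [mg _] := orbit_bmf act_cont y bg.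
rewrite integral_dirac//; last exact/measurable_EFinP.
by rewrite diracT mul1e.
Qed.

Lemma iter_transfer_time_one n (f : X -> R) y : bcont f ->
  iter n (transfer act time_one) f y = f (act (a n%:R) y).
Proof.
move=> bf; elim: n y => [|n ih] y; first by rewrite (flow0 a_sub) (act1 act_cont).
rewrite /= transfer_time_one.
  by rewrite ih -(actM act_cont) -(flowD a_sub) natr1.
exact: (iter_transfer_bcont H_lcsc act_cont a_sub K_sub time_one_supp).
Qed.

Lemma flow_mean_invariant n (f : X -> R) : bcont f -> (forall y, 0 <= f y <= 1) ->
  flow_mean act a x T (iter n (transfer act time_one) f) -
    flow_mean act a x T f @[T --> +oo] --> 0.
Proof.
move=> bf f01; have [ca _] := a_sub; have [cf _] := bf.
pose phi t := f (act (a t) x).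
have bphi : bmf phi by exact: (flow_bmf act_cont a_sub).
have cphi : continuous phi.
  move=> t; apply: (@continuous_comp _ _ _ (fun t => act (a t) x) f); last exact: cf.
  by apply: (continuous_act act_cont ca); exact: cst_continuous.
have n0 : 0 <= n%:R :> R by [].
have bnd s t : s <= t -> 0 <= itv_integral phi s t <= t - s.
  move=> st; rewrite itv_integral_ge0 /=; last by move=> u; case/andP: (f01 (act (a u) x)).
  rewrite -[leRHS]mul1r -itv_integral_cst//.
  by apply: itv_integral_le => // [|u _]; [exact: bmf_cst|case/andP: (f01 (act (a u) x))].
apply/cvgrPdist_le => e e0.
exists (n%:R / e); split; first exact: num_real.
move=> T nT; have T0 : 0 < T by apply: le_lt_trans nT; rewrite divr_ge0// ltW.
rewrite sub0r normrN /flow_mean -mulrBr.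
have -> : itv_integral (fun t => iter n (transfer act time_one) f (act (a t) x)) 0 T =
    itv_integral phi n%:R (T + n%:R).
  rewrite -[X in itv_integral phi X]add0r -(itv_integral_shift _ cphi bphi (ltW T0)).
  congr (itv_integral _ 0 T); apply/funext => t.
  by rewrite iter_transfer_time_one// -(actM act_cont) -(flowD a_sub) addrC.
have s1 : itv_integral phi 0 (T + n%:R) =
    itv_integral phi 0 n%:R + itv_integral phi n%:R (T + n%:R).
  by apply: itv_integral_split => //; rewrite n0 lerDr ltW.
have s2 : itv_integral phi 0 (T + n%:R) =
    itv_integral phi 0 T + itv_integral phi T (T + n%:R).
  by apply: itv_integral_split => //; rewrite lerDl n0 ltW.
have /andP[b1 b2] := bnd 0 n%:R n0.
have /andP[b3 b4] : 0 <= itv_integral phi T (T + n%:R) <= (T + n%:R) - T.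
  by apply: bnd; rewrite lerDl.
have diff : `|itv_integral phi n%:R (T + n%:R) - itv_integral phi 0 T| <= n%:R.
  by rewrite ler_norml; apply/andP; split; lra.
rewrite normrM ger0_norm ?invr_ge0 ?(ltW T0)// ler_pdivrMl//.
apply: (le_trans diff).
by move: nT; rewrite ltr_pdivrMr// => /ltW.
Qed.

(** The sums of [P^(n+1) f] over positions [0 .. N - 1] and [1 .. N] differ by two
boundary terms. *)
Lemma walk_mean_invariant (nu : probability (borel H) R) (f : X -> R)
    (b : nat -> H) :
  (forall n y, 0 <= iter n (transfer act nu) f y <= 1) ->
  (forall n, N%:R^-1 * (\sum_(p < N) (iter n (transfer act nu) f (act (walk b p.+1) x) -
      iter n.+1 (transfer act nu) f (act (walk b p) x))) @[N --> \oo] --> 0) ->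
  forall n, walk_mean act x b N (iter n (transfer act nu) f) -
    walk_mean act x b N f @[N --> \oo] --> 0.
Proof.
move=> f01 law; elim=> [|n ih].
  by under eq_fun do rewrite subrr; exact: cvg_cst.
set g := iter n.+1 (transfer act nu) f.
have g01 y : 0 <= g y <= 1 by exact: f01.
have endpoints : N%:R^-1 * (g (act (walk b N) x) - g x) @[N --> \oo] --> 0.
  apply/cvgrPdist_le => e e0.
  exists (Num.truncn e^-1).+1 => // N /= NT.
  have N0 : 0 < N%:R :> R by rewrite ltr0n; apply: leq_trans NT.
  rewrite sub0r normrN normrM ger0_norm ?invr_ge0 ?ler0n// ler_pdivrMl//.
  apply: (@le_trans _ _ 1).
    have /andP[? ?] := g01 x; have /andP[? ?] := g01 (act (walk b N) x).
    by rewrite ler_norml; apply/andP; split; lra.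
  rewrite -ler_pdivrMr// mul1r; apply: ltW; apply: (lt_le_trans (truncnS_gt _)).
  by rewrite ler_nat.
have stepE N : walk_mean act x b N g - walk_mean act x b N f =
    (walk_mean act x b N (iter n (transfer act nu) f) - walk_mean act x b N f) -
    N%:R^-1 * (\sum_(p < N) (iter n (transfer act nu) f (act (walk b p.+1) x) -
      g (act (walk b p) x))) +
    N%:R^-1 * (g (act (walk b N) x) - g x).
  have tele : \sum_(p < N) g (act (walk b p.+1) x) =
      \sum_(p < N) g (act (walk b p) x) + (g (act (walk b N) x) - g x).
    elim: N => [|N ihN].
      by rewrite !big_ord0 /= (act1 act_cont) subrr addr0.
    by rewrite !big_ord_recr /= ihN; ring.
  by rewrite /walk_mean tele sumrB; ring.
have -> : 0 = 0 - 0 + 0 :> R by rewrite subr0 addr0.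
under eq_fun do rewrite stepE.
by apply: cvgD => //; apply: cvgB => //; exact: law.
Qed.

End asymptotic_invariance.

(** * The equivalence *)
Lemma ae_walk_in_support (R : realType) (H : topologicalGroupType)
    (nu : probability (borel H) R) (nuN : probability (seq_space H) R)
    (L : set (borel H)) : is_infinite_product nu nuN ->
  measurable L -> nu L = 1%E ->
  {ae nuN, forall b : nat -> H, forall i, L (b i)}.
Proof.
move=> nuN_prod mL nuL.
apply: (@ae_foralln _ _ R nuN (fun i (b : seq_space H) => L (b i))) => i.
have mLi : measurable [set b : seq_space H | L (b i)].
  rewrite -[X in measurable X]setTI.
  exact: coordinate_measurable.
have nuLi : nuN [set b : seq_space H | L (b i)] = 1%E.
  have := nuN_prod i.+1 (fun j => if j == i then L else setT) _.
  have -> : [set b | forall j, (j < i.+1)%N -> (if j == i then L else setT) (b j)] =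
      [set b : seq_space H | L (b i)].
    apply/seteqP; split=> b /=; last by move=> Lb j _; case: eqP => // ->.
    by move=> /(_ i (ltnSn i)); rewrite eqxx.
  move=> ->; last by move=> j; case: ifP.
  rewrite big1// => j _; case: ifP => // _.
  exact: probability_setT.
exists (~` [set b : seq_space H | L (b i)]); split=> //.
- exact: measurableC.
- apply: (etrans (probability_setC nuN mLi)).
  by rewrite nuLi subee.
Qed.

Theorem theorem1p9 (R : realType)
  (X : ptopologicalType) (X_lcsc : lcsc X) (X_hom : homogeneous_space X)
  (H : topologicalGroupType) (H_lcsc : lcsc H)
  (act : H -> X -> X) (act_cont : continuous_action act)
  (m : probability (borel X) R)
  (m_inv : invariant_measure act m) (m_mix : mixing act m)
  (a : R -> H) (a_sub : one_parameter_subgroup a)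
  (a_infty : a t @[t --> +oo] --> at_infinity H)
  (K : set H) (K_sub : compact_subgroup K)
  (K_comm : forall t k, K k -> (a t * k)%g = (k * a t)%g)
  (nu : probability (borel H) R)
  (c d : R) (c_gt0 : 0 < c) (c_le_d : c <= d)
  (nu_supp : nu [set (a t * k)%g | t in `[c, d] & k in K] = 1%E)
  (nuN : probability (seq_space H) R) (nuN_prod : is_infinite_product nu nuN)
  (x : X) :
  weak_star_cvg (pinfty_nbhs R) (flow_average act a x) m
  <->
  {ae nuN, forall b : nat -> H, weak_star_cvg \oo (walk_average R act b x) m}.
Proof.
have {}nu_supp : nu (strip a K c d) = 1%E by exact: nu_supp.
have [ca _] := a_sub.
have [Phi PhiP] := countable_test_family R X_lcsc.
have [PhiC _] := PhiP.
have PhiB j : bcont (Phi j) by apply: Cc_bcont; case: (PhiC j).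
have Phi01 j : forall y, 0 <= Phi j y <= 1 by case: (PhiC j).
have flow_ex T : exists P : probability (borel X) R, 0 < T ->
    (forall A, measurable A -> flow_average act a x T A = P A) /\
    forall f : X -> R, bmf (f : borel X -> R) ->
      \int[P]_y f y = flow_mean act a x T f.
  have [T0|T0] := ltP 0 T; last by exists m.
  by have [P PP] := flow_average_probability act_cont x ca T0; exists P.
have /choice[flowP flowPP] := flow_ex.
have flow_near : \forall T \near +oo, 0 < T :> R by exact: nbhs_pinfty_gt.
have flowA : \forall T \near +oo, forall A, measurable A ->
    flow_average act a x T A = flowP T A.
  by apply: filterS flow_near => T /flowPP[].
have flowE f : bmf (f : borel X -> R) -> \forall T \near +oo,
    \int[flowP T]_y f y = flow_mean act a x T f.
  by move=> bf; apply: filterS flow_near => T /flowPP[_]; exact.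
have walk_ex (b : nat -> H) N : exists P : probability (borel X) R, (0 < N)%N ->
    (forall A, walk_average R act b x N A = P A) /\
    forall f : X -> R, bmf (f : borel X -> R) ->
      \int[P]_y f y = walk_mean act x b N f.
  have [N0|N0] := posnP N; first by exists m.
  by have [P PP] := walk_average_probability R act b x N0; exists P.
have walk_near : \forall N \near \oo, (0 < N)%N by exists 1%N.
have aeF : Filter (almost_everywhere nuN) by exact: ae_filter_ringOfSetsType.
have support_ae := ae_walk_in_support nuN_prod
  (strip_measurable H_lcsc a_sub K_sub c d) nu_supp.
have bit j n : bcont (iter n (transfer act nu) (Phi j)).
  exact: (iter_transfer_bcont H_lcsc act_cont a_sub K_sub nu_supp).
have it01 j n y : 0 <= iter n (transfer act nu) (Phi j) y <= 1.
  exact: (iter_transfer01 H_lcsc act_cont a_sub K_sub nu_supp).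
split.
- move=> /(weak_star_cvgP m flowA) flow_cvg.
  have flow_bcont h : bcont h -> flow_mean act a x T h @[T --> +oo] --> \int[m]_y h y.
    move=> bh; apply: cvg_trans (Cc_cvg_bcont PhiP flow_cvg bh).
    by apply: near_eq_cvg; apply: filterS (flowE h (bcont_bmf bh)) => T ->.
  have law_ae : {ae nuN, forall b : nat -> H, forall j n,
      N%:R^-1 * (\sum_(p < N) (iter n (transfer act nu) (Phi j) (act (walk b p.+1) x) -
        iter n.+1 (transfer act nu) (Phi j) (act (walk b p) x))) @[N --> \oo] --> 0}.
    apply: (@ae_foralln _ _ R nuN (fun j (b : seq_space H) => forall n,
      N%:R^-1 * (\sum_(p < N) (iter n (transfer act nu) (Phi j) (act (walk b p.+1) x) -
        iter n.+1 (transfer act nu) (Phi j) (act (walk b p) x))) @[N --> \oo] --> 0)) => j.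
    apply: (@ae_foralln _ _ R nuN (fun n (b : seq_space H) =>
      N%:R^-1 * (\sum_(p < N) (iter n (transfer act nu) (Phi j) (act (walk b p.+1) x) -
        iter n.+1 (transfer act nu) (Phi j) (act (walk b p) x))) @[N --> \oo] --> 0)) => n.
    exact: (walk_transfer_law H_lcsc act_cont nuN_prod x (bit j n) (it01 j n)
      (bit j n.+1) (it01 j n.+1)).
  apply: (@filterS2 _ _ aeF _ _ _ _ support_ae law_ae) => b bs law.
  have /choice[walkP walkPb] := walk_ex b.
  have walkE f : bmf (f : borel X -> R) -> \forall N \near \oo,
      \int[walkP N]_y f y = walk_mean act x b N f.
    by move=> bf; apply: filterS walk_near => N /walkPb[_]; exact.
  apply/(weak_star_cvgP (mu := walkP) m).
    by apply: filterS walk_near => N /walkPb[NA _] A _; exact: NA.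
  apply: (test_family_cvg PhiP) => j.
  apply: (orbit_dominated_cvg X_lcsc H_lcsc act_cont a_sub K_sub K_comm nu_supp
    m_inv m_mix a_infty c_gt0 c_le_d _ _ _ (Phi01 j)).
  + exists 2 => // G G1.
    have [C C0 dom] := walk_dominated act_cont a_sub K_sub K_comm c_gt0 c_le_d
      m_inv bs flow_bcont G1.
    exists C => // h e bh h01 e0 hG eta eta0.
    apply: filterS2 (dom h e bh h01 e0 hG eta eta0) (walkE h (bcont_bmf bh)).
    by move=> N + ->.
  + by case: (PhiC j).
  + move=> n; apply: cvg_trans (walk_mean_invariant act_cont (it01 j) (law j) n).
    apply: near_eq_cvg.
    apply: filterS2 (walkE _ (bcont_bmf (bit j n))) (walkE _ (bcont_bmf (PhiB j))).
    by move=> N -> ->.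
- move=> walk_ae.
  have [b [bs]] : exists b : nat -> H, (forall i, strip a K c d (b i)) /\
      weak_star_cvg \oo (walk_average R act b x) m.
    have : {ae nuN, forall b : nat -> H, (forall i, strip a K c d (b i)) /\
        weak_star_cvg \oo (walk_average R act b x) m}.
      by apply: (@filterS2 _ _ aeF _ _ _ _ support_ae walk_ae) => b.
    have aeP : ProperFilter (almost_everywhere nuN).
      apply: ae_properfilter_algebraOfSetsType.
      have : (0 < nuN setT)%E by rewrite probability_setT.
      exact.
    by move=> /(@filter_ex _ _ aeP)[b bP]; exists b.
  have /choice[walkP walkPb] := walk_ex b.
  have walkE f : bmf (f : borel X -> R) -> \forall N \near \oo,
      \int[walkP N]_y f y = walk_mean act x b N f.
    by move=> bf; apply: filterS walk_near => N /walkPb[_]; exact.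
  have walkA : \forall N \near \oo, forall A, measurable A ->
      walk_average R act b x N A = walkP N A.
    by apply: filterS walk_near => N /walkPb[NA _] A _; exact: NA.
  move=> /(weak_star_cvgP m walkA) walk_cvg.
  have walk_bcont h : bcont h -> walk_mean act x b N h @[N --> \oo] --> \int[m]_y h y.
    move=> bh; apply: cvg_trans (Cc_cvg_bcont PhiP walk_cvg bh).
    by apply: near_eq_cvg; apply: filterS (walkE h (bcont_bmf bh)) => N ->.
  apply/(weak_star_cvgP m flowA).
  apply: (test_family_cvg PhiP) => j.
  apply: (orbit_dominated_cvg X_lcsc H_lcsc act_cont a_sub K_sub K_comm
    (time_one_supp a K_sub) m_inv m_mix a_infty ltr01 (lexx 1) _ _ _ (Phi01 j)).
  + exists (2 * d / c); first by rewrite divr_ge0 ?mulr_ge0 ?(ltW c_gt0)// (le_trans (ltW c_gt0)).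
    move=> G G1.
    have [C C0 dom] := flow_dominated act_cont a_sub K_sub K_comm c_gt0 c_le_d
      m_inv bs walk_bcont G1.
    exists C => // h e bh h01 e0 hG eta eta0.
    apply: filterS2 (dom h e bh h01 e0 hG eta eta0) (flowE h (bcont_bmf bh)).
    by move=> T + ->.
  + by case: (PhiC j).
  + move=> n.
    apply: cvg_trans (flow_mean_invariant H_lcsc act_cont a_sub K_sub x n (PhiB j) (Phi01 j)).
    have bn : bcont (iter n (transfer act (time_one a)) (Phi j)).
      exact: (iter_transfer_bcont H_lcsc act_cont a_sub K_sub (time_one_supp a K_sub)).
    apply: near_eq_cvg.
    apply: filterS2 (flowE _ (bcont_bmf bn)) (flowE _ (bcont_bmf (PhiB j))).
    by move=> T -> ->.
Qed.
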